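(* Let $a\in C^\infty(\mathbb T^1)$ be real-valued and consider the vector field $Y=\partial_t+a(t)\partial_x$ on $\mathbb T^2$. There exist $\delta\ge2$ and $c_a>0$ such that $$\|\nabla_{\mathbb T^2}f\|_{L^2(\mathbb T^2)}^{\delta-1}\,\|Yf\|_{L^2(\mathbb T^2)}\ \ge\ c_a\,\|f\|_{L^2(\mathbb T^2)}^\delta$$ for every $f\in H^1(\mathbb T^2)$ with mean value zero, if and only if $a_0=\frac1{2\pi}\int_0^{2\pi}a(t)\,dt$ is an irrational non-Liouville number. Moreover, in this case one can take any $\delta$ greater than the irrationality measure of $a_0$, or $\delta=2$ if $a_0$ is algebraic of degree $2$.
   Context: $\mathbb T^n=\mathbb R^n/(2\pi\mathbb Z)^n$; coordinates on $\mathbb T^2$ are $(t,x)$ and $\nabla_{\mathbb T^2}f=(\partial_tf,\partial_xf)$. The irrationality measure of an irrational $\alpha\in\mathbb R$ is the infimum of all $\mu>0$ such that $|\alpha-p/q|\ge|q|^{-\mu}$ for all integers $p,q$ with $|q|$ sufficiently large (infinite if no such $\mu$ exists, i.e. if $\alpha$ is a Liouville number). *)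

(* Defs.v *)
From HB Require Import structures.
From mathcomp Require Import all_boot all_order all_algebra.
From mathcomp Require Import all_classical all_reals all_analysis.
From mathcomp Require Import complex.

Set Implicit Arguments.
Unset Strict Implicit.
Unset Printing Implicit Defensive.

Import Order.TTheory GRing.Theory Num.Theory.
Import numFieldNormedType.Exports.
Import Normc.

Local Open Scope classical_set_scope.
Local Open Scope ring_scope.
Local Open Scope complex_scope.

(* Functions on T^n = R^n / (2 pi Z)^n are functions on R^n that are
   2 pi-periodic in each variable; integrals over T^n are integrals over the
   fundamental cell [0, 2 pi]^n for the (unnormalised) Lebesgue measure. *)

Section Circle.
Context {R : realType}.

Definition smooth_circle (a : R -> R) : Prop :=
  periodic a (pi *+ 2) /\ forall (n : nat) (t : R), derivable (derive1n n a) t 1.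

Definition circle_mean (a : R -> R) : R :=
  (pi *+ 2)^-1 * \int[lebesgue_measure]_(t in `[0, pi *+ 2]) a t.

End Circle.

Section Torus.
Context {R : realType}.
Implicit Types (f g h : R * R -> R[i]) (phi : R * R -> R).

Definition torus_periodic (T : Type) (f : R * R -> T) : Prop :=
  forall t x : R,
    f (t + pi *+ 2, x) = f (t, x) /\ f (t, x + pi *+ 2) = f (t, x).

Definition torus_cell : set (measurableTypeR R * measurableTypeR R) :=
  `[0, pi *+ 2] `*` `[0, pi *+ 2].

Definition lebesgue2 := (@lebesgue_measure R \x @lebesgue_measure R)%E.

Definition torus_Cintegral f : R[i] :=
  (\int[lebesgue2]_(z in torus_cell) complex.Re (f z))
    +i* (\int[lebesgue2]_(z in torus_cell) complex.Im (f z)).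

Definition torus_L2 f : Prop :=
  [/\ torus_periodic f,
      measurable_fun [set: measurableTypeR R * measurableTypeR R] (@complex.Re R \o f),
      measurable_fun [set: measurableTypeR R * measurableTypeR R] (@complex.Im R \o f)
    & lebesgue2.-integrable torus_cell (fun z => (normc (f z) ^+ 2)%:E)].

Definition L2norm f : R :=
  Num.sqrt (\int[lebesgue2]_(z in torus_cell) (normc (f z) ^+ 2)).

(* The L^2 norm of the vector-valued function (g, h). *)
Definition L2norm2 g h : R := Num.sqrt (L2norm g ^+ 2 + L2norm h ^+ 2).

Definition partial_t phi : R * R -> R := 'D_((1, 0) : R * R) phi.
Definition partial_x phi : R * R -> R := 'D_((0, 1) : R * R) phi.

(* phi is C^oo when all its iterated partial derivatives, in any order, are
   differentiable; s lists the successive variables (true for t). *)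
Definition smooth_torus phi : Prop :=
  torus_periodic phi /\
  forall (s : seq bool) (z : R * R),
    differentiable
      (foldr (fun b => if b then partial_t else partial_x) phi s) z.

(* Weak derivatives, tested against real C^oo(T^2); complex test functions
   give the same notion by linearity. *)
Definition weak_partial_t f g : Prop :=
  forall phi, smooth_torus phi ->
    torus_Cintegral (fun z => f z * (partial_t phi z)%:C)
    = - torus_Cintegral (fun z => g z * (phi z)%:C).

Definition weak_partial_x f g : Prop :=
  forall phi, smooth_torus phi ->
    torus_Cintegral (fun z => f z * (partial_x phi z)%:C)
    = - torus_Cintegral (fun z => g z * (phi z)%:C).

(* f belongs to the (complex) Sobolev space H^1(T^2) and its gradient is
   (ft, fx), which is determined by f almost everywhere. *)
Definition H1_gradient f ft fx : Prop :=
  [/\ torus_L2 f, torus_L2 ft, torus_L2 fx,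
      weak_partial_t f ft & weak_partial_x f fx].

Definition directional (a : R -> R) ft fx : R * R -> R[i] :=
  fun z => ft z + (a z.1)%:C * fx z.

Definition directional_poincare (a : R -> R) (delta : R) : Prop :=
  2 <= delta /\
  exists2 c : R, 0 < c &
    forall f ft fx, H1_gradient f ft fx -> torus_Cintegral f = 0 ->
      c * L2norm f `^ delta
        <= L2norm2 ft fx `^ (delta - 1) * L2norm (directional a ft fx).

End Torus.

Section Diophantine.
Context {R : realType}.

Definition approximation_exponent (alpha mu : R) : Prop :=
  0 < mu /\
  exists N : nat, forall p q : int, (N < `|q|)%N ->
    (`|q|%N%:R : R) `^ (- mu) <= `|alpha - p%:~R / q%:~R|.

(* Equal to +oo when there is no such exponent. *)
Definition irrationality_measure (alpha : R) : \bar R :=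
  ereal_inf [set mu%:E | mu in approximation_exponent alpha].

Definition liouville (alpha : R) : Prop :=
  irrational alpha /\ irrationality_measure alpha = +oo%E.

Definition algebraic_of_degree (alpha : R) (d : nat) : Prop :=
  exists p : {poly rat},
    [/\ irreducible_poly p, size p = d.+1 & root (map_poly ratr p) alpha].

End Diophantine.

(* Main.v *)
(* Let A be a primitive of a - a_0; it is 2 pi-periodic, so the functions
   exp(i(l t + k(x - A(t)))) form an orthogonal basis of L^2(T^2), on which Y acts with
   eigenvalue i(l + k a_0), while d/dx and d/dt + (a - a_0) d/dx act with eigenvalues ik and il;
   the latter two are bounded by the gradient.  If |l + k a_0| >= c |k|^(1 - delta), then for
   every cut-off K each nonzero mode satisfies
     1 <= |l + k a_0|^2 (K^(delta - 1) / c)^2 + (l^2 + k^2) / K^2,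
   hence |f|^2 <= (K^(delta - 1) / c)^2 |Yf|^2 + C |grad f|^2 / K^2, and optimising K gives the
   inequality.  Conversely the inequality tested on the basis functions bounds |l + k a_0| from
   below by a power of |l| + |k|.  Dirichlet's theorem shows that exponents exceed 2, and
   Liouville's argument gives delta = 2 for quadratic a_0.
   Since Y is real, everything is done separately for the real and imaginary parts of f, with
   the real basis of cosines and sines indexed by half of the lattice.  Its completeness is
   obtained from the L^2-closed span: the bounded functions in it form an algebra, which by
   polynomial approximation contains the indicators of all measurable sets. *)

Require Import Defs.
From HB Require Import structures.
From mathcomp Require Import all_boot all_order all_algebra.
From mathcomp Require Import all_classical all_reals all_analysis.
From mathcomp Require Import measurable_realfun complex.
From mathcomp Require Import ring lra.

Set Implicit Arguments.
Unset Strict Implicit.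
Unset Printing Implicit Defensive.

Import Order.TTheory GRing.Theory Num.Theory.
Import numFieldNormedType.Exports.

Local Open Scope classical_set_scope.
Local Open Scope ring_scope.

(** The spectral argument uses finite sums only. A finite trigonometric polynomial close to f
    selects finitely many modes that carry all but e of its energy, and Bessel's inequality on these
    modes controls the weighted sums by the energies of Yf and of the two auxiliary fields. As f has
    only weak derivatives, the eigenvalue relations are imposed on coefficients, by testing against
    the modes, which are smooth because a is. The twist is the obstacle to density: a mode with k
    nonzero is not adapted to sets depending on x. The modes with k = 0 are untwisted and already
    yield all sets depending on t. As A depends on t only, exp(iA(t)) then lies in the closure, and
    multiplying exp(i(x - A(t))) by it recovers exp(ix), hence the sets depending on x, then
    rectangles. The converse loses one unit in the exponent: a constant is absorbed by an extra
    factor |q|. This is harmless, since only the finiteness of the irrationality measure is at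
    stake. *)

(** * Real L^2 inner product, finite orthogonal projections and Bessel's inequality *)

Section SquareIntegrable.
Context d (T : measurableType d) (R : realType).
Variables (mu : {measure set T -> \bar R}) (D : set T) (mD : measurable D).
Implicit Types (u v w q : T -> R).

Definition sqint u :=
  measurable_fun setT u /\ mu.-integrable D (fun z => (u z ^+ 2)%:E).

Definition ip u v : R := \int[mu]_(z in D) (u z * v z).

(** Domination by u^2 + v^2, which bounds |u v|. *)
Lemma sqint_mul u v : sqint u -> sqint v ->
  mu.-integrable D (fun z => (u z * v z)%:E).
Proof.
move=> [mu_ iu] [mv iv].
apply: (le_integrable mD _ _ (integrableD mD iu iv)) => /=.
  apply/measurable_EFinP/(measurable_funS measurableT) => //.
  exact: measurable_funM.
move=> z _ /=; rewrite lee_fin.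
rewrite (ger0_norm (_ : 0 <= u z ^+ 2 + v z ^+ 2)); last first.
  by rewrite addr_ge0 ?sqr_ge0.
rewrite ler_norml; apply/andP; split; nra.
Qed.

Lemma sqintD u v : sqint u -> sqint v -> sqint (fun z => u z + v z).
Proof.
move=> su sv; split.
  by apply: measurable_funD; [exact: su.1|exact: sv.1].
have -> : (fun z => ((u z + v z) ^+ 2)%:E) =
  ((fun z => (u z * u z)%:E) \+ (fun z => (2 * (u z * v z))%:E) \+ (fun z => (v z * v z)%:E))%E.
  by apply/funext => z /=; rewrite -!EFinD; congr EFin; ring.
apply: integrableD => //; last exact: sqint_mul.
apply: integrableD => //; first exact: sqint_mul.
by apply: (@integrableZl _ _ _ _ _ mD 2 (fun z => (u z * v z)%:E)); exact: sqint_mul.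
Qed.

Lemma sqintZ (r : R) u : sqint u -> sqint (fun z => r * u z).
Proof.
move=> su; split.
  by apply: measurable_funM; [exact: measurable_cst|exact: su.1].
have -> : (fun z => ((r * u z) ^+ 2)%:E) = (fun z => (r ^+ 2)%:E * (u z * u z)%:E)%E.
  by apply/funext => z /=; rewrite -EFinM; congr EFin; ring.
by apply: integrableZl => //; exact: sqint_mul.
Qed.

Lemma sqintN u : sqint u -> sqint (fun z => - u z).
Proof.
move=> /(sqintZ (-1)) su; rewrite (_ : (fun z => - u z) = (fun z => -1 * u z))//.
by apply/funext => z; rewrite mulN1r.
Qed.

Lemma sqintB u v : sqint u -> sqint v -> sqint (fun z => u z - v z).
Proof. by move=> su sv; apply: sqintD => //; exact: sqintN. Qed.

Lemma sqint0 : sqint (fun=> 0).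
Proof.
split; first exact: measurable_cst.
by rewrite (_ : (fun _ => _) = cst 0%E); [exact: integrable0|apply/funext => z; rewrite expr0n].
Qed.

Lemma sqint_sum (I : Type) (S : seq I) (phi : I -> T -> R) (c : I -> R) :
  (forall i, sqint (phi i)) -> sqint (fun z => \sum_(i <- S) c i * phi i z).
Proof.
move=> sphi; elim: S => [|i S IH].
  by rewrite (_ : (fun _ => _) = fun=> 0); [exact: sqint0|apply/funext => z; rewrite big_nil].
rewrite (_ : (fun _ => _) = fun z => c i * phi i z + \sum_(i <- S) c i * phi i z).
  by apply: sqintD => //; apply: sqintZ.
by apply/funext => z; rewrite big_cons.
Qed.

Lemma ipC u v : ip u v = ip v u.
Proof. by apply: eq_Rintegral => z _; rewrite mulrC. Qed.

Lemma ipDl u v w : sqint u -> sqint v -> sqint w ->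
  ip (fun z => u z + v z) w = ip u w + ip v w.
Proof.
move=> su sv sw; rewrite /ip -RintegralD//; [|exact: sqint_mul..].
by apply: eq_Rintegral => z _; rewrite mulrDl.
Qed.

Lemma ipZl r u w : sqint u -> sqint w ->
  ip (fun z => r * u z) w = r * ip u w.
Proof.
move=> su sw; rewrite /ip -RintegralZl//; last exact: sqint_mul.
by apply: eq_Rintegral => z _; rewrite mulrA.
Qed.

Lemma ipBl u v w : sqint u -> sqint v -> sqint w ->
  ip (fun z => u z - v z) w = ip u w - ip v w.
Proof.
move=> su sv sw; rewrite /ip -RintegralB//; [|exact: sqint_mul..].
by apply: eq_Rintegral => z _; rewrite mulrBl.
Qed.

Lemma ip0l u : ip (fun=> 0) u = 0.
Proof.
rewrite /ip (@eq_Rintegral _ _ _ mu D (fun=> 0)) => [|z _]; last by rewrite mul0r.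
by rewrite Rintegral_cst// mul0r.
Qed.

Lemma ip_suml (I : Type) (S : seq I) (phi : I -> T -> R) (c : I -> R) w :
  (forall i, sqint (phi i)) -> sqint w ->
  ip (fun z => \sum_(i <- S) c i * phi i z) w = \sum_(i <- S) c i * ip (phi i) w.
Proof.
move=> sphi sw; elim: S => [|i S IH].
  rewrite big_nil (_ : (fun _ => _) = fun=> 0) ?ip0l//.
  by apply/funext => z; rewrite big_nil.
rewrite big_cons -IH -ipZl// -ipDl//.
- by congr ip; apply/funext => z; rewrite big_cons.
- exact: sqintZ.
- exact: sqint_sum.
Qed.

Lemma ip_ge0 u : 0 <= ip u u.
Proof. by apply: Rintegral_ge0 => z _; rewrite -expr2 sqr_ge0. Qed.

Lemma ip_le u v : sqint u -> sqint v -> (forall z, D z -> u z ^+ 2 <= v z ^+ 2) ->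
  ip u u <= ip v v.
Proof.
move=> su sv uv; apply: le_Rintegral => //.
- exact: sqint_mul.
- exact: (sqint_mul sv sv).
Qed.

Lemma ip_sqrD u v : sqint u -> sqint v ->
  ip (fun z => u z + v z) (fun z => u z + v z) = ip u u + 2 * ip u v + ip v v.
Proof.
move=> su sv; have suv := sqintD su sv.
rewrite ipDl// ![ip _ (fun z => _ + _)]ipC !ipDl// (ipC v u); ring.
Qed.

Lemma ip_sqrB u v : sqint u -> sqint v ->
  ip (fun z => u z - v z) (fun z => u z - v z) = ip u u - 2 * ip u v + ip v v.
Proof.
move=> su sv; have suv := sqintB su sv.
rewrite ipBl// ![ip _ (fun z => _ - _)]ipC !ipBl// (ipC v u); ring.
Qed.

(** Parallelogram identity with the term of u - v dropped. *)
Lemma ip_sqrD_le u v : sqint u -> sqint v ->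
  ip (fun z => u z + v z) (fun z => u z + v z) <= 2 * ip u u + 2 * ip v v.
Proof.
move=> su sv; have := ip_ge0 (fun z => u z - v z).
rewrite ip_sqrB// ip_sqrD//; lra.
Qed.

Section Bessel.
Variables (I : choiceType) (phi : I -> T -> R) (S : seq I).
Hypothesis sphi : forall i, sqint (phi i).
Hypothesis uS : uniq S.
Hypothesis orth : forall i j, i \in S -> j \in S -> i != j -> ip (phi i) (phi j) = 0.
Hypothesis phi_gt0 : forall i, i \in S -> 0 < ip (phi i) (phi i).

Definition orth_proj u z := \sum_(i <- S) (ip u (phi i) / ip (phi i) (phi i)) * phi i z.
(** The squared norm of [orth_proj u]; the family is orthogonal but not normalised, hence the
    divisions. *)
Definition energy u := \sum_(i <- S) ip u (phi i) ^+ 2 / ip (phi i) (phi i).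

Lemma sqint_orth_proj u : sqint (orth_proj u).
Proof. exact: sqint_sum. Qed.

Lemma ip_orth_proj u i : i \in S -> ip (orth_proj u) (phi i) = ip u (phi i).
Proof.
move=> iS; rewrite /orth_proj ip_suml// (bigD1_seq i)//= mulfVK ?gt_eqF ?phi_gt0//.
rewrite [X in _ + X]big_seq_cond big1 ?addr0// => j /andP[jS ji].
by rewrite (orth jS iS ji) mulr0.
Qed.

Lemma ip_sub_orth_proj u i : sqint u -> i \in S ->
  ip (fun z => u z - orth_proj u z) (phi i) = 0.
Proof.
move=> su iS; rewrite ipBl//; last exact: sqint_orth_proj.
by rewrite ip_orth_proj// subrr.
Qed.

Lemma ip_orth_proj_self u : sqint u ->
  ip (fun z => u z - orth_proj u z) (orth_proj u) = 0.
Proof.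
move=> su; have sp := sqint_orth_proj u.
rewrite ipC {1}/orth_proj ip_suml//; last exact: sqintB.
rewrite big_seq big1// => i iS.
by rewrite (ipC _ (fun z => u z - _)) ip_sub_orth_proj// mulr0.
Qed.

Lemma energyE u : sqint u -> 
  ip u u = ip (fun z => u z - orth_proj u z) (fun z => u z - orth_proj u z) + energy u.
Proof.
move=> su; have sp := sqint_orth_proj u; have sup := sqintB su sp.
rewrite [in LHS](_ : u = fun z => (u z - orth_proj u z) + orth_proj u z); last first.
  by apply/funext => z; rewrite subrK.
rewrite ip_sqrD// ip_orth_proj_self// mulr0 addr0; congr (_ + _).
rewrite {1}/orth_proj ip_suml// /energy big_seq [RHS]big_seq.
apply: eq_bigr => i iS; rewrite (ipC _ (orth_proj u)) ip_orth_proj// expr2; ring.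
Qed.

Lemma bessel u : sqint u -> energy u <= ip u u.
Proof. by move=> su; rewrite energyE// lerDr ip_ge0. Qed.

(** Pythagoras: u - Pu is orthogonal both to Pu and to q, so its norm is at most that of u - q.
    Membership of q in the span enters only through this orthogonality. *)
Lemma best_approx u q : sqint u -> sqint q ->
  ip (fun z => u z - orth_proj u z) q = 0 ->
  ip u u <= energy u + ip (fun z => u z - q z) (fun z => u z - q z).
Proof.
move=> su sq uq0; have sp := sqint_orth_proj u; have sup := sqintB su sp; have spq := sqintB sp sq.
rewrite energyE// addrC lerD2l.
rewrite [leRHS](_ : _ = ip (fun z => (u z - orth_proj u z) + (orth_proj u z - q z))
   (fun z => (u z - orth_proj u z) + (orth_proj u z - q z))); last first.
  by congr ip; apply/funext => z; ring.
rewrite (ip_sqrD sup spq).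
rewrite [ip _ (fun z => orth_proj u z - q z)]ipC (ipBl sp sq sup).
rewrite (ipC (orth_proj u)) ip_orth_proj_self// (ipC q) uq0 subrr mulr0 addr0 lerDl ip_ge0 //.
Qed.

End Bessel.
End SquareIntegrable.

(** * Polynomials converging to a step function on the unit interval *)

Section PolynomialStep.
Variable R : realType.
Implicit Types x u : R.

Lemma bernoulli_sub x n : 0 <= x <= 1 -> 1 - n%:R * x <= (1 - x) ^+ n.
Proof.
move=> /andP[x0 x1]; elim: n => [|n IH]; first by rewrite mul0r subr0 expr0.
rewrite exprS -natr1.
have : (1 - x) * (1 - n%:R * x) <= (1 - x) * (1 - x) ^+ n.
  by apply: ler_wpM2l => //; rewrite subr_ge0.
have : 0 <= n%:R * x ^+ 2 by rewrite mulr_ge0 ?ler0n ?sqr_ge0.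
nra.
Qed.

Lemma bernoulli_add x n : 0 <= x -> 1 + n%:R * x <= (1 + x) ^+ n.
Proof.
move=> x0; elim: n => [|n IH]; first by rewrite mul0r addr0 expr0.
rewrite exprS -natr1.
have : (1 + x) * (1 + n%:R * x) <= (1 + x) * (1 + x) ^+ n.
  by apply: ler_wpM2l => //; rewrite addr_ge0.
have : 0 <= n%:R * x ^+ 2 by rewrite mulr_ge0 ?ler0n ?sqr_ge0.
nra.
Qed.

(** Multiply by (1 + x)^n: the product (1 - x^2)^n is at most 1, and Bernoulli bounds (1 + x)^n from
    below. *)
Lemma expr_sub_le x n : 0 <= x <= 1 -> (1 - x) ^+ n <= (1 + n%:R * x)^-1.
Proof.
move=> /andP[x0 x1]; have nx : 0 <= n%:R * x by rewrite mulr_ge0.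
rewrite -[leRHS]mul1r ler_pdivlMr; last by rewrite ltr_pwDl.
apply: (@le_trans _ _ ((1 - x) ^+ n * (1 + x) ^+ n)).
  by apply: ler_wpM2l; [rewrite exprn_ge0 ?subr_ge0|exact: bernoulli_add].
rewrite -exprMn exprn_ile1//; nra.
Qed.

(** Write x = y^2. Bernoulli for 1/y = 1 + h keeps n y^n below 1/h, and the remaining factor y^n
    tends to 0. *)
Lemma cvg_natr_expr x : 0 <= x < 1 -> (fun n => n%:R * x ^+ n) @ \oo --> (0 : R).
Proof.
move=> /andP[x0 x1]; have [->|xn0] := eqVneq x 0.
  apply: cvg_near_cst; near=> n; rewrite expr0n.
  by rewrite (_ : n == 0%N = false) ?mulr0//; apply/negbTE; rewrite -lt0n; near: n;
    exact: nbhs_infty_gt.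
have xp : 0 < x by rewrite lt_neqAle eq_sym xn0.
pose y := Num.sqrt x; have yp : 0 < y by rewrite sqrtr_gt0.
have y1 : y < 1 by rewrite -sqrtr1 ltr_sqrt.
have yy : x = y * y by rewrite -expr2 sqr_sqrtr.
pose h := y^-1 - 1; have hp : 0 < h by rewrite subr_gt0 invf_gt1.
apply: (@squeeze_cvgr _ _ _ _ (fun=> 0) (fun n => h^-1 * y ^+ n)).
- near=> n; apply/andP; split; first by rewrite mulr_ge0 ?exprn_ge0.
  have ny : n%:R * y ^+ n <= h^-1.
    rewrite -[leRHS]mul1r ler_pdivlMr//.
    have -> : n%:R * y ^+ n * h = (n%:R * h) * y ^+ n by ring.
    rewrite -ler_pdivlMr ?exprn_gt0// div1r -exprVn.
    have -> : y^-1 = 1 + h by rewrite /h addrC subrK.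
    by apply: le_trans (bernoulli_add n (ltW hp)); rewrite lerDr.
  by rewrite yy exprMn mulrA; apply: ler_wpM2r => //; rewrite exprn_ge0 ?ltW.
- exact: cvg_cst.
- rewrite -[X in _ --> X](mulr0 h^-1); apply: cvgM; first exact: cvg_cst.
  by apply: cvg_expr; rewrite ger0_norm ?ltW.
Unshelve. all: by end_near. Qed.

(* The polynomials of Brosowski and Deutsch's proof of Stone-Weierstrass; the extra factor [n]
   in the exponent makes the limit at [1/2] equal to [0] rather than [1/e]. *)
Lemma cvg_poly_step u : 0 <= u <= 1 ->
  (fun n => (1 - u ^+ n) ^+ (n * 2 ^ n)) @ \oo --> ((u < 2^-1)%R%:R : R).
Proof.
move=> /andP[u0 u1].
have un n : 0 <= u ^+ n <= 1 by rewrite exprn_ge0// exprn_ile1.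
case: ltP => hu /=.
  apply: (@squeeze_cvgr _ _ _ _ (fun n => 1 - n%:R * (2 * u) ^+ n) (fun=> 1)).
  - near=> n; apply/andP; split; last first.
      have /andP[a b] := un n.
      by rewrite exprn_ile1 ?subr_ge0// lerBlDr lerDl.
    apply: le_trans (bernoulli_sub _ (un n)).
    by rewrite natrM natrX exprMn mulrA.
  - rewrite -[X in _ --> X]subr0; apply: cvgB; first exact: cvg_cst.
    apply: cvg_natr_expr; apply/andP; split; lra.
  - exact: cvg_cst.
(* For u at least 1/2 the product n 2^n u^n is at least n, so [expr_sub_le] gives the bound 1/(n +
   1). *)
apply: (@squeeze_cvgr _ _ _ _ (fun=> 0) (fun n => n.+1%:R^-1)).
- near=> n; have /andP[a b] := un n.
  rewrite exprn_ge0 ?subr_ge0//=.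
  apply: le_trans (expr_sub_le _ (un n)) _.
  have nu : 0 <= (n * 2 ^ n)%:R * u ^+ n by rewrite mulr_ge0.
  rewrite lef_pV2 ?posrE//; last by rewrite ltr_pwDl.
  rewrite -natr1 addrC lerD2l natrM natrX -mulrA -exprMn ler_peMr//.
  by rewrite exprn_ege1//; lra.
- exact: cvg_cst.
- exact: cvg_harmonic.
Unshelve. all: by end_near. Qed.

End PolynomialStep.

(** * The L^2 closure of an algebra of bounded functions *)

Section L2Closure.
Context d (T : measurableType d) (R : realType).
Variables (mu : {measure set T -> \bar R}) (D : set T) (mD : measurable D).
Hypothesis muD : (mu D < +oo)%E.
Notation sqint := (sqint mu D).
Notation ip := (ip mu D).

Definition bdd_fun (h : T -> R) :=
  measurable_fun setT h /\ exists M : R, forall z, `|h z| <= M.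

Lemma bdd_funD h h' : bdd_fun h -> bdd_fun h' -> bdd_fun (fun z => h z + h' z).
Proof.
move=> [mh [M hM]] [mh' [M' hM']]; split; first exact: measurable_funD.
exists (M + M') => z; rewrite (le_trans (ler_normD _ _))// lerD//.
Qed.

Lemma bdd_funM h h' : bdd_fun h -> bdd_fun h' -> bdd_fun (fun z => h z * h' z).
Proof.
move=> [mh [M hM]] [mh' [M' hM']]; split; first exact: measurable_funM.
by exists (M * M') => z; rewrite normrM ler_pM.
Qed.

Lemma bdd_fun_cst (c : R) : bdd_fun (fun=> c).
Proof. by split; [exact: measurable_cst|exists `|c|]. Qed.

Lemma bdd_funX h n : bdd_fun h -> bdd_fun (fun z => h z ^+ n).
Proof.
move=> bh; elim: n => [|n IH]; first exact: bdd_fun_cst.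
by under eq_fun do rewrite exprS; exact: bdd_funM.
Qed.

Lemma bdd_fun_integrable h : bdd_fun h -> mu.-integrable D (fun z => (h z)%:E).
Proof.
move=> [mh [M hM]]; apply: (@measurable_bounded_integrable _ _ _ _ h) => //.
  exact: measurable_funS mh.
exists M; split; first exact: num_real.
by move=> x Mx z _ /=; rewrite (le_trans (hM z))// ltW.
Qed.

Lemma bdd_fun_sqint h : bdd_fun h -> sqint h.
Proof. by move=> bh; split; [exact: bh.1|apply: bdd_fun_integrable; exact: bdd_funX]. Qed.

(** The bound is asked on [D] only, so that it applies to continuous functions of the plane, which
    are bounded on the compact cell. *)
Lemma sqintM_bdd (u v : T -> R) (M : R) : sqint u -> measurable_fun setT v ->
  (forall z, D z -> `|v z| <= M) -> sqint (fun z => u z * v z).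
Proof.
move=> su mv vM; have mu_ := su.1.
split; first exact: measurable_funM.
apply: (@le_integrable _ _ _ _ _ mD _ (fun z => ((M ^+ 2)%:E * (u z ^+ 2)%:E)%E)).
- apply/measurable_EFinP/(measurable_funS measurableT) => //.
  by apply: measurable_funX; exact: measurable_funM.
- move=> z Dz; rewrite -EFinM !abse_EFin lee_fin.
  have uv0 : 0 <= M ^+ 2 * u z ^+ 2 by apply: mulr_ge0; exact: sqr_ge0.
  rewrite (ger0_norm uv0) ger0_norm ?sqr_ge0//.
  rewrite exprMn mulrC ler_wpM2r ?sqr_ge0//.
  by rewrite -[v z ^+ 2]real_normK ?num_real// ler_pXn2r// ?vM// nnegrE (le_trans _ (vM z Dz)).
- exact: (@integrableZl _ _ _ _ _ mD (M ^+ 2) (fun z => (u z ^+ 2)%:E) su.2).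
Qed.

Lemma ipM_bdd_le (u v : T -> R) (M : R) : sqint u -> measurable_fun setT v -> (forall z, D z ->
  `|v z| <= M) ->
  ip (fun z => u z * v z) (fun z => u z * v z) <= M ^+ 2 * ip u u.
Proof.
move=> su mv vM.
have suv : sqint (fun z => u z * v z) by exact: (sqintM_bdd su mv vM).
have sMu : sqint (fun z => M * u z) by exact: sqintZ.
apply: le_trans (ip_le mD suv sMu _) _.
  move=> z Dz; rewrite !exprMn mulrC ler_wpM2r ?sqr_ge0// -[v z ^+ 2]real_normK ?num_real//.
  by rewrite ler_pXn2r// ?vM// nnegrE (le_trans _ (vM z Dz)).
by rewrite ipZl// (ipC _ _ u (fun z => M * u z)) ipZl// mulrA -expr2.
Qed.

Definition sqdist u v := ip (fun z => u z - v z) (fun z => u z - v z).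

(** Squared distances avoid roots at the price of the factors 2, whence the tolerances e / 4
    below. *)
Lemma sqdist_triangle u v w : sqint u -> sqint v -> sqint w ->
  sqdist u w <= 2 * sqdist u v + 2 * sqdist v w.
Proof.
move=> su sv sw; have suv := sqintB mD su sv; have svw := sqintB mD sv sw.
rewrite /sqdist [leLHS](_ : _ = ip (fun z => (u z - v z) + (v z - w z))
  (fun z => (u z - v z) + (v z - w z))); first exact: ip_sqrD_le.
by congr ip; apply/funext => z; ring.
Qed.

Variable A : set (T -> R).
Hypothesis A_bdd : forall q, A q -> bdd_fun q.
Hypothesis A_cst : forall c, A (fun=> c).
Hypothesis A_add : forall q q', A q -> A q' -> A (fun z => q z + q' z).
Hypothesis A_mul : forall q q', A q -> A q' -> A (fun z => q z * q' z).

(** Elements are genuine functions, not classes modulo null sets; [L2cl_ae] restores the invariance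
    under null sets. *)
Definition L2cl (h : T -> R) :=
  sqint h /\ forall e : R, 0 < e -> exists2 q, A q & sqdist h q <= e.

Lemma A_sqint q : A q -> sqint q.
Proof. by move=> Aq; exact/bdd_fun_sqint/A_bdd. Qed.

Lemma sqdistxx h : sqdist h h = 0.
Proof.
rewrite /sqdist (_ : (fun z => h z - h z) = fun=> 0) ?ip0l//.
by apply/funext => z; rewrite subrr.
Qed.

Lemma L2cl_A q : A q -> L2cl q.
Proof.
by move=> Aq; split; [exact: A_sqint|move=> e e0; exists q => //; rewrite sqdistxx ltW].
Qed.

Lemma L2cl_closed h : sqint h ->
  (forall e : R, 0 < e -> exists2 g, L2cl g & sqdist h g <= e) -> L2cl h.
Proof.
move=> sh H; split => // e e0.
have e4 : 0 < e / 4 by rewrite divr_gt0.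
have [g [sg gA] hg] := H _ e4; have [q Aq gq] := gA _ e4.
exists q => //; apply: le_trans (sqdist_triangle sh sg (A_sqint Aq)) _.
lra.
Qed.

Lemma L2clD h h' : L2cl h -> L2cl h' -> L2cl (fun z => h z + h' z).
Proof.
move=> [sh Ah] [sh' Ah']; split; first exact: sqintD.
move=> e e0; have e4 : 0 < e / 4 by rewrite divr_gt0.
have [q Aq hq] := Ah _ e4; have [q' Aq' hq'] := Ah' _ e4.
exists (fun z => q z + q' z); first exact: A_add.
have sq := A_sqint Aq; have sq' := A_sqint Aq'.
rewrite /sqdist [leLHS](_ : _ = ip (fun z => (h z - q z) + (h' z - q' z))
  (fun z => (h z - q z) + (h' z - q' z))); last first.
  by congr ip; apply/funext => z; ring.
apply: le_trans (ip_sqrD_le mD (sqintB mD sh sq) (sqintB mD sh' sq')) _.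
rewrite -!/(sqdist _ _); lra.
Qed.

Lemma sqdistM_le (h q v : T -> R) (M : R) : sqint h -> sqint q -> measurable_fun setT v ->
  (forall z, `|v z| <= M) ->
  sqdist (fun z => h z * v z) (fun z => q z * v z) <= M ^+ 2 * sqdist h q.
Proof.
move=> sh sq mv vM; rewrite [leLHS](_ : _ = ip (fun z => (h z - q z) * v z) (fun z => (h z - q
  z) * v z)).
  by apply: ipM_bdd_le => //; exact: sqintB.
by congr ip; apply/funext => z; rewrite mulrBl.
Qed.

Lemma small_mul (M e : R) : 0 < e -> exists2 e', 0 < e' & M ^+ 2 * e' <= e.
Proof.
move=> e0; have M0 : 0 < M ^+ 2 + 1 by rewrite ltr_pwDr ?sqr_ge0.
(* The added 1 covers M = 0. *)
exists (e / (M ^+ 2 + 1)); first by rewrite divr_gt0.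
by rewrite mulrA ler_pdivrMr// mulrC ler_wpM2l ?lerDl// ltW.
Qed.

Lemma L2clM_A h q : L2cl h -> A q -> L2cl (fun z => h z * q z).
Proof.
move=> [sh Ah] Aq; have [mq [M qM]] := A_bdd Aq.
split; first by apply: (sqintM_bdd sh mq) => z _; exact: qM.
move=> e /(small_mul M)[e' e'0 Me']; have [q' Aq' hq'] := Ah _ e'0.
exists (fun z => q' z * q z); first exact: A_mul.
apply: le_trans (sqdistM_le sh (A_sqint Aq') mq qM) _.
by apply: le_trans Me'; rewrite ler_wpM2l// sqr_ge0.
Qed.

(** The factors are approximated one at a time: the bounded h stays fixed while h' is replaced by
    some q of [A], and then [L2clM_A] treats h q. Only one factor has to be bounded. *)
Lemma L2clM h h' : L2cl h -> L2cl h' -> bdd_fun h -> L2cl (fun z => h z * h' z).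
Proof.
move=> cl_h [sh' Ah'] bh; have [mh [M hM]] := bh.
apply: L2cl_closed.
  by under eq_fun do rewrite mulrC; apply: (sqintM_bdd sh' mh) => z _; exact: hM.
move=> e /(small_mul M)[e' e'0 Me']; have [q Aq hq] := Ah' _ e'0.
exists (fun z => h z * q z); first exact: L2clM_A.
rewrite (_ : (fun z => h z * h' z) = fun z => h' z * h z); last by apply/funext => z; rewrite mulrC.
rewrite (_ : (fun z => h z * q z) = fun z => q z * h z); last by apply/funext => z; rewrite mulrC.
apply: le_trans (sqdistM_le sh' (A_sqint Aq) mh hM) _.
by apply: le_trans Me'; rewrite ler_wpM2l// sqr_ge0.
Qed.

Lemma L2cl_cst (c : R) : L2cl (fun=> c).
Proof. exact: L2cl_A. Qed.

Lemma L2clZ c h : L2cl h -> L2cl (fun z => c * h z).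
Proof. by move=> ch; apply: L2clM => //; [exact: L2cl_cst|exact: bdd_fun_cst]. Qed.

Lemma L2clB h h' : L2cl h -> L2cl h' -> L2cl (fun z => h z - h' z).
Proof.
move=> ch ch'; rewrite (_ : (fun z => h z - h' z) = (fun z => h z + (-1) * h' z)).
  by apply: L2clD => //; exact: L2clZ.
by apply/funext => z; rewrite mulN1r.
Qed.

Lemma L2clX h n : L2cl h -> bdd_fun h -> L2cl (fun z => h z ^+ n).
Proof.
move=> ch bh; elim: n => [|n IH]; first exact: L2cl_cst.
by under eq_fun do rewrite exprS; exact: L2clM.
Qed.

Lemma L2cl_sum (I : Type) (s : seq I) (c : I -> R) (phi : I -> T -> R) :
  (forall i, L2cl (phi i)) -> L2cl (fun z => \sum_(i <- s) c i * phi i z).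
Proof.
move=> cphi; elim: s => [|i s IH].
  by under eq_fun do rewrite big_nil; exact: L2cl_cst.
under eq_fun do rewrite big_cons.
by apply: L2clD => //; exact: L2clZ.
Qed.

(** Dominated convergence for the squared differences. *)
Lemma L2cl_cvg (h_ : nat -> T -> R) (h g : T -> R) (N : set T) :
  measurable N -> mu N = 0%E ->
  (forall n, L2cl (h_ n)) -> sqint h -> mu.-integrable D (fun z => (g z)%:E) ->
  (forall n z, D z -> (h z - h_ n z) ^+ 2 <= g z) ->
  (forall z, D z -> ~ N z -> h_ ^~ z @ \oo --> h z) -> L2cl h.
Proof.
move=> mN N0 clh sh ig hg hcvg; apply: L2cl_closed => // e e0.
have mh n : measurable_fun D (fun z => ((h z - h_ n z) ^+ 2)%:E).
  apply/measurable_EFinP; apply: (measurable_funS measurableT) => //.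
  by apply: measurable_funX; apply: measurable_funB; [exact: sh.1|exact: (clh n).1.1].
have h1 : {ae mu, forall z, D z ->
    (fun n => ((h z - h_ n z) ^+ 2)%:E) @ \oo --> (cst 0%E : T -> \bar R) z}.
  exists N; split => // z /= /not_implyP[Dz Hz]; apply: contrapT => Nz; apply: Hz.
  apply: cvg_EFin; first by apply: nearW.
  rewrite /comp/= -[X in _ --> X](expr0n R 2) -(subrr (h z)).
  apply: (@cvg_comp _ _ _ _ (fun x : R => x ^+ 2)).
    by apply: cvgB; [exact: cvg_cst|exact: hcvg].
  exact: exprn_continuous.
have h2 : {ae mu, forall z n, D z -> (`|((h z - h_ n z) ^+ 2)%:E| <= (g z)%:E)%E}.
  by apply: aeW => z n Dz /=; rewrite lee_fin ger0_norm ?sqr_ge0// hg.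
have [_ _] := @dominated_convergence _ _ _ mu D mD
  (fun n z => ((h z - h_ n z) ^+ 2)%:E) (cst 0%E) (fun z => (g z)%:E) mh
  (measurable_cst _) h1 ig h2.
rewrite integral0 => /fine_cvg /= /cvgr_lt /(_ _ e0) [n _ /(_ n (leqnn _)) /= Hn].
exists (h_ n) => //; apply/ltW; move: Hn; rewrite /sqdist /ip /Rintegral; congr (fine _ < _).
Qed.

Lemma L2cl_ae h h' N : measurable N -> mu N = 0%E -> L2cl h -> sqint h' ->
  (forall z, D z -> ~ N z -> h z = h' z) -> L2cl h'.
Proof.
move=> mN N0 ch sh' hh'.
apply: (@L2cl_cvg (fun=> h) h' (fun z => (h' z - h z) ^+ 2) N) => //.
  by apply: (sqintB mD sh' ch.1).2.
by move=> z Dz Nz; rewrite hh'//; exact: cvg_cst.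
Qed.

(* The bounded functions of [L2cl] form an algebra stable under bounded pointwise limits, so
   [L2set] is a sigma-algebra; by the polynomial step it contains their sublevel sets. *)
Definition L2set (E : set T) := measurable E /\ L2cl (\1_E).

Lemma bdd_fun_indic (E : set T) : measurable E -> bdd_fun (\1_E : T -> R).
Proof.
move=> mE; split; first exact: measurable_indic.
by exists 1 => z; rewrite indicE; case: (_ \in _); rewrite ?normr1 ?normr0.
Qed.

Lemma bdd_fun_sub_sqr (h h' : T -> R) (M : R) : (forall z, `|h z| <= M) -> (forall z, `|h' z|
  <= M) ->
  forall z, (h z - h' z) ^+ 2 <= 4 * M ^+ 2.
Proof.
move=> hM hM' z; have := hM z; have := hM' z.
by rewrite !ler_norml => /andP[? ?] /andP[? ?]; nra.
Qed.

Lemma L2cl_bcvg (h_ : nat -> T -> R) (h : T -> R) (M : R) :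
  (forall n, L2cl (h_ n)) -> measurable_fun setT h ->
  (forall n z, `|h_ n z| <= M) -> (forall z, `|h z| <= M) ->
  (forall z, h_ ^~ z @ \oo --> h z) -> L2cl h.
Proof.
move=> clh mh hnM hM hcvg.
apply: (@L2cl_cvg h_ h (fun=> 4 * M ^+ 2) set0) => //.
- by apply: bdd_fun_sqint; split => //; exists M.
- by apply: bdd_fun_integrable; exact: bdd_fun_cst.
- by move=> n z _; apply: (@bdd_fun_sub_sqr h (h_ n) M hM (hnM n)).
Qed.

Lemma L2set_setC E : L2set E -> L2set (~` E).
Proof.
move=> [mE cE]; split; first exact: measurableC.
rewrite (_ : \1_(~` E) = (fun z => 1 - \1_E z)); first by apply: L2clB => //; exact: L2cl_cst.
apply/funext => z; rewrite !indicE in_setC.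
by case: (_ \in _); rewrite /= ?subrr ?subr0.
Qed.

Lemma L2set_setI E F : L2set E -> L2set F -> L2set (E `&` F).
Proof.
move=> [mE cE] [mF cF]; split; first exact: measurableI.
rewrite (_ : \1_(E `&` F) = (fun z => \1_E z * \1_F z)).
  by apply: L2clM => //; exact: bdd_fun_indic.
by apply/funext => z; rewrite !indicE in_setI -natrM mulnb.
Qed.

Lemma L2set_set0 : L2set set0.
Proof. by split => //; rewrite indic0; exact: L2cl_cst. Qed.

Lemma L2set_setU E F : L2set E -> L2set F -> L2set (E `|` F).
Proof.
by move=> cE cF; rewrite -[E `|` F]setCK setCU; apply: L2set_setC; apply: L2set_setI;
  exact: L2set_setC.
Qed.

Lemma indic_norm_le1 (E : set T) z : `|\1_E z| <= 1 :> R.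
Proof. by rewrite indicE; case: (_ \in _); rewrite ?normr1 ?normr0. Qed.

Lemma L2set_bigcup (E : nat -> set T) : (forall n, L2set (E n)) -> L2set (\bigcup_n E n).
Proof.
move=> cE; have mE : measurable (\bigcup_n E n).
  by apply: bigcupT_measurable => n; exact: (cE n).1.
split => //.
pose F n := \big[setU/set0]_(k < n) E k.
have cF n : L2set (F n).
  rewrite /F; elim: n => [|n IH]; first by rewrite big_ord0; exact: L2set_set0.
  by rewrite big_ord_recr; exact: L2set_setU.
apply: (@L2cl_bcvg (fun n => \1_(F n)) _ 1) => //.
- by move=> n; exact: (cF n).2.
- by move=> n z; exact: indic_norm_le1.
- by move=> z; exact: indic_norm_le1.
move=> z; have [[k _ Ekz]|nE] := pselect ((\bigcup_n E n) z).
  apply: cvg_near_cst; near=> n; rewrite !indicE !mem_set//; first by exists k.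
  rewrite /F -bigcup_mkord; exists k => //=.
  by near: n; exact: nbhs_infty_gt.
apply: cvg_near_cst; near=> n; rewrite !indicE !memNset//.
by rewrite /F -bigcup_mkord => -[k /= _ Ekz]; apply: nE; exists k.
Unshelve. all: by end_near. Qed.

Lemma L2set_ae E E' N : measurable N -> mu N = 0%E -> L2set E -> measurable E' ->
  (forall z, D z -> ~ N z -> E z <-> E' z) -> L2set E'.
Proof.
move=> mN N0 [mE cE] mE' EE'; split => //; apply: (L2cl_ae mN N0 cE).
  by apply: bdd_fun_sqint; exact: bdd_fun_indic.
by move=> z Dz Nz; rewrite !indicE; congr (_%:R); congr nat_of_bool; apply/idP/idP;
  rewrite !inE => /EE'; exact.
Qed.

Lemma L2set_lt v c : L2cl v -> bdd_fun v -> L2set [set z | v z < c].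
Proof.
move=> cv bv; have [mv [M vM]] := bv.
have mE : measurable [set z | v z < c].
  have -> : [set z | v z < c] = setT `&` v @^-1` `]-oo, c[.
    by apply/seteqP; split => z /=; rewrite in_itv/=; [|case].
  exact: mv.
split => //.
(* This [K] is at least 2 |v - c|, so the affine image [u] of v stays in [0, 1] and v < c becomes u
   < 1/2, the threshold of the polynomial step. *)
pose K := 2 * (`|M| + `|c| + 1).
have K0 : 0 < K by rewrite mulr_gt0// ltr_wpDl// addr_ge0.
pose u z := 2^-1 + K^-1 * (v z - c).
have uc : L2cl u.
  apply: L2clD; first exact: L2cl_cst.
  by apply: L2clZ; apply: L2clB => //; exact: L2cl_cst.
have ub : bdd_fun u.
  apply: bdd_funD; first exact: bdd_fun_cst.
  apply: bdd_funM; first exact: bdd_fun_cst.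
  by apply: bdd_funD => //; exact: bdd_fun_cst.
have u01 z : 0 <= u z <= 1.
  have : `|K^-1 * (v z - c)| <= 2^-1.
    rewrite normrM gtr0_norm ?invr_gt0// mulrC ler_pdivrMr//.
    have -> : 2^-1 * K = `|M| + `|c| + 1 by rewrite /K; field.
    apply: le_trans (ler_normB _ _) _.
    have := vM z; have := ler_norm M; lra.
  by rewrite ler_norml /u => /andP[? ?]; apply/andP; split; lra.
have p01 n z : `|(1 - u z ^+ n) ^+ (n * 2 ^ n)| <= 1.
  have /andP[u0 u1] := u01 z.
  have ? : 0 <= 1 - u z ^+ n by rewrite subr_ge0 exprn_ile1.
  rewrite ger0_norm ?exprn_ge0// exprn_ile1// lerBlDr lerDl exprn_ge0//.
apply: (@L2cl_bcvg (fun n z => (1 - u z ^+ n) ^+ (n * 2 ^ n)) _ 1) => //.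
- move=> n; apply: L2clX.
    by apply: L2clB; [exact: L2cl_cst|exact: L2clX].
  apply: (@bdd_funD (fun=> 1) (fun z => - u z ^+ n)); first exact: bdd_fun_cst.
  rewrite (_ : (fun z => - u z ^+ n) = fun z => -1 * u z ^+ n).
    by apply: bdd_funM; [exact: bdd_fun_cst|exact: bdd_funX].
  by apply/funext => z; rewrite mulN1r.
- by move=> z; exact: indic_norm_le1.
move=> z; have := cvg_poly_step (u01 z).
rewrite indicE (_ : (u z < 2^-1) = (z \in [set z | v z < c])) => //.
rewrite /u gtrDl pmulr_rlt0 ?invr_gt0// subr_lt0.
by apply/idP/idP; rewrite inE.
Qed.

Lemma L2set_preimage (T' : Type) (pi : T -> T') (G : set (set T')) :
  (forall B, G B -> L2set (pi @^-1` B)) ->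
  forall B, <<s G >> B -> L2set (pi @^-1` B).
Proof.
move=> GL; have : <<s G >> `<=` [set B | L2set (pi @^-1` B)].
  apply: smallest_sub => //; split => /=.
  - by rewrite preimage_set0; exact: L2set_set0.
  - by move=> B cB; rewrite setTD preimage_setC; exact: L2set_setC.
  - by move=> B cB; rewrite preimage_bigcup; exact: L2set_bigcup.
by move=> H B /H.
Qed.

Import HBNNSimple.

(** Simple functions increase to h, and 0 <= g_n <= h gives the dominating function h^2. The map
    [pi] is a coordinate in one application and the identity in the other. *)
Lemma L2cl_comp d' (T' : measurableType d') (pi : T -> T') (h : T' -> R) :
  (forall B, measurable B -> L2set (pi @^-1` B)) -> measurable_fun setT h ->
  (forall x, 0 <= h x) -> sqint (h \o pi) -> L2cl (h \o pi).
Proof.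
move=> cpi mh h0 shpi.
have mEh : measurable_fun setT (EFin \o h) by apply/measurable_EFinP.
pose g := nnsfun_approx measurableT mEh.
have cg x : (EFin \o g ^~ x) @ \oo --> (h x)%:E.
  by apply: cvg_nnsfun_approx => // y _ /=; rewrite lee_fin.
have gh n x : g n x <= h x.
  have cgR : (fun n => g n x) @ \oo --> h x by exact: (fine_cvg (cg x)).
  rewrite -(cvg_lim (@Rhausdorff R) cgR); apply: nondecreasing_cvgn_le.
    by move=> i j ij; exact/lefP/nd_nnsfun_approx.
  by apply/cvg_ex; exists (h x).
apply: (@L2cl_cvg (fun n => g n \o pi) _ (fun z => h (pi z) ^+ 2) set0) => //.
- move=> n.
  have [s sE] : exists s : seq R, forall x, g n x = \sum_(y <- s) y * \1_(g n @^-1` [set y]) x.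
    by exists (finmap.enum_fset (fset_set (range (g n)))) => x; rewrite {1}fimfunE fsbig_finite.
  rewrite (_ : g n \o pi = fun z => \sum_(y <- s) y * \1_(pi @^-1` (g n @^-1` [set y])) z).
    apply: L2cl_sum => y; apply: (cpi _ _).2.
    by rewrite -[X in measurable X]setTI; exact: measurable_funP.
  by apply/funext => z; rewrite /= {1}sE; apply: eq_bigr => y _; rewrite !indicE.
- exact: shpi.2.
- move=> n z _ /=; have := gh n (pi z); have : 0 <= g n (pi z) by exact: fun_ge0.
  by move=> ? ?; nra.
- by move=> z _ _; exact: (fine_cvg (cg (pi z))).
Qed.

(** [L2cl_comp] treats nonnegative functions, and u is the difference of u + |u| and |u|. *)
Lemma L2cl_all : (forall E, measurable E -> L2set E) -> forall u, sqint u -> L2cl u.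
Proof.
move=> H.
have H0 v : sqint v -> (forall z, 0 <= v z) -> L2cl v.
  by move=> sv v0; apply: (@L2cl_comp _ _ id v) => //; exact: sv.1.
move=> u su.
have sn : sqint (fun z => `|u z|).
  split; first by apply: measurableT_comp => //; exact: su.1.
  by under eq_fun do rewrite real_normK ?num_real//; exact: su.2.
rewrite (_ : u = fun z => (u z + `|u z|) - `|u z|); last by apply/funext => z; rewrite addrK.
apply: L2clB; apply: H0 => //.
  exact: sqintD.
by move=> z; have := ler_norm (- u z); rewrite normrN; lra.
Qed.

End L2Closure.

(** * Measurability, Fubini and integration of partial derivatives over the cell *)

Section TorusIntegration.
Context {R : realType}.
Notation mu := (@lebesgue_measure R).
Notation RR := (measurableTypeR R * measurableTypeR R)%type.
Notation leb2 := (@lebesgue2 R).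
Notation cell := (@torus_cell R).
Notation M := (pi *+ 2 : R).

Lemma per_gt0 : 0 < M.
Proof. by rewrite mulrn_wgt0// pi_gt0. Qed.

Lemma continuous_pair_r (c x : R) : {for x, continuous (fun y : R => (c, y))}.
Proof. by apply/differentiable_continuous; exact: differentiable_pair. Qed.

Lemma continuous_pair_l (c x : R) : {for x, continuous (fun y : R => (y, c))}.
Proof. by apply/differentiable_continuous; exact: differentiable_pair. Qed.

Lemma continuous_line_t (f : R * R -> R) x : continuous f -> continuous (fun t => f (t, x)).
Proof. by move=> cf t; apply: continuous_comp; [exact: continuous_pair_l|exact: cf]. Qed.

Lemma continuous_line_x (f : R * R -> R) t : continuous f -> continuous (fun x => f (t, x)).
Proof. by move=> cf x; apply: continuous_comp; [exact: continuous_pair_r|exact: cf]. Qed.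

(** Measurability is for the product sigma-algebra. Rounding t down to a multiple of 1/(n + 1) gives
    a function that on each of countably many strips depends continuously on x alone; f is the
    pointwise limit. *)
Lemma continuous2_measurable (f : R * R -> R) : continuous f ->
  measurable_fun [set: RR] f.
Proof.
move=> cf.
pose q (n : nat) (t : R) : R := (Num.floor (t * n.+1%:R))%:~R / n.+1%:R.
apply: (@measurable_fun_cvg _ RR R setT (fun n z => f (q n z.1, z.2))).
  move=> n _ Y mY; rewrite setTI.
  pose E (k : int) : set RR := [set t : measurableTypeR R | Num.floor (t * n.+1%:R) = k] `*`
     [set x : measurableTypeR R | Y (f (k%:~R / n.+1%:R, x))].
  rewrite (_ : _ @^-1` _ = \bigcup_k E k); last first.
    apply/seteqP; split => [[t x]/= Yf|[t x] [k _ [/= <-]]//].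
    by exists (Num.floor (t * n.+1%:R)).
  apply: countable_bigcupT_measurable => // k; apply: measurableX.
    rewrite (_ : [set t | _] = `[k%:~R / n.+1%:R, (k + 1)%:~R / n.+1%:R[%classic);
      first exact: measurable_itv.
    apply/seteqP; split => t /=; rewrite in_itv/= ler_pdivrMr// ltr_pdivlMr//.
      by move/eqP; rewrite floor_eq.
    by rewrite -floor_eq => /eqP.
  rewrite -[X in measurable X]setTI.
  apply: (@continuous_measurable_fun R (fun x => f (k%:~R / n.+1%:R, x))) => //.
  exact: continuous_line_x.
move=> [t x] _ /=; apply: (@cvg_comp _ _ _ (q ^~ t) (fun y => f (y, x))); last first.
  exact: continuous_line_t.
apply/cvgrPdist_le => e e0; near=> n.
have n0 : 0 < n.+1%:R :> R by [].
have /andP[h1 h2] := floor_itv (t * n.+1%:R).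
rewrite /q -[X in X - _](mulfK (lt0r_neq0 n0)) -mulrBl normrM normfV (gtr0_norm n0).
rewrite ler_pdivrMr// ger0_norm ?subr_ge0//.
apply: (@le_trans _ _ 1); first by move: h2; rewrite intrD; lra.
have : n.+1%:R^-1 < e by near: n; exact: (near_infty_natSinv_lt (PosNum e0)).
by move/ltW; rewrite -div1r ler_pdivrMr.
Unshelve. all: by end_near. Qed.


Lemma measurable_cell : measurable (cell : set RR).
Proof. by apply: measurableX; exact: measurable_itv. Qed.

Lemma lebesgue2_cell : leb2 cell = (M ^+ 2)%:E.
Proof.
rewrite /lebesgue2 /torus_cell product_measure1E; try exact: measurable_itv.
by rewrite /= !lebesgue_measure_itv /= lte_fin per_gt0 sube0 -EFinM expr2.
Qed.

Lemma cell_lty : (leb2 cell < +oo)%E.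
Proof. by rewrite lebesgue2_cell ltry. Qed.

Lemma continuous_cell_bounded (f : R * R -> R) : continuous f ->
  exists K, forall z, cell z -> `|f z| <= K.
Proof.
move=> cf; have cc : compact cell by apply: compact_setX; exact: segment_compact.
have cfc : {within cell, continuous f} by exact: continuous_subspaceT.
have [K [_ KP]] := compact_bounded (continuous_compact cfc cc).
exists (K + 1) => z cz; apply: KP; first by rewrite ltrDl.
by exists z.
Qed.

Lemma continuous_cell_integrable (f : R * R -> R) : continuous f ->
  leb2.-integrable cell (fun z => (f z)%:E).
Proof.
move=> cf; have [K KP] := continuous_cell_bounded cf.
apply: (@measurable_bounded_integrable _ RR R leb2 f) => //.
- exact: measurable_cell.
- exact: cell_lty.
- by apply: measurable_funS (continuous2_measurable cf).
- exists K; split; first exact: num_real.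
  by move=> x Kx z cz /=; rewrite (le_trans (KP z cz))// ltW.
Qed.

(** Fubini after extension by zero. Integrability of the slices matters because [Rintegral] is also
    0 for an infinite integral. *)
Lemma Rintegral_cell_x0 (f : R * R -> R) : leb2.-integrable cell (fun z => (f z)%:E) ->
  (forall t, \int[mu]_(x in `[0, M]) f (t, x) = 0) ->
  (forall t, mu.-integrable `[0, M] (fun x => (f (t, x))%:E)) ->
  \int[leb2]_(z in cell) f z = 0.
Proof.
move=> fi f0 fti; rewrite /Rintegral integral_mkcond.
have fiT : leb2.-integrable setT ((EFin \o f) \_ cell).
  by apply/(integrable_mkcond _ measurable_cell).
rewrite -(integral12_prod_meas1 fiT).
rewrite (eq_integral (cst 0%E)) ?integral0// => t _.
rewrite /fubini_F; have [tI|tI] := pselect (`[0, M]%classic t).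
  rewrite [LHS](_ : _ = (\int[mu]_(x in `[0%R, M]) (f (t, x))%:E)%E); last first.
    rewrite [RHS]integral_mkcond; apply: eq_integral => x _.
    by rewrite /patch /torus_cell in_setX /= (mem_set tI).
  by rewrite -[LHS]fineK ?integrable_fin_num// -[fine _]/(Rintegral mu _ _) f0.
rewrite (eq_integral (cst 0%E)) ?integral0// => x _.
by rewrite /patch /torus_cell in_setX /= (memNset tI).
Qed.

Lemma Rintegral_cell_t0 (f : R * R -> R) : leb2.-integrable cell (fun z => (f z)%:E) ->
  (forall x, \int[mu]_(t in `[0, M]) f (t, x) = 0) ->
  (forall x, mu.-integrable `[0, M] (fun t => (f (t, x))%:E)) ->
  \int[leb2]_(z in cell) f z = 0.
Proof.
move=> fi f0 fti; rewrite /Rintegral integral_mkcond.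
have fiT : leb2.-integrable setT ((EFin \o f) \_ cell).
  by apply/(integrable_mkcond _ measurable_cell).
rewrite -(integral21_prod_meas1 fiT).
rewrite (eq_integral (cst 0%E)) ?integral0// => x _.
rewrite /fubini_G; have [xI|xI] := pselect (`[0, M]%classic x).
  rewrite [LHS](_ : _ = (\int[mu]_(t in `[0%R, M]) (f (t, x))%:E)%E); last first.
    rewrite [RHS]integral_mkcond; apply: eq_integral => t _.
    by rewrite /patch /torus_cell in_setX /= (mem_set xI) andbT.
  by rewrite -[LHS]fineK ?integrable_fin_num// -[fine _]/(Rintegral mu _ _) f0.
rewrite (eq_integral (cst 0%E)) ?integral0// => t _.
by rewrite /patch /torus_cell in_setX /= (memNset xI) andbF.
Qed.

Lemma partial_tE (phi : R * R -> R) z :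
  partial_t phi z = derive1 (fun t => phi (t, z.2)) z.1.
Proof.
rewrite /partial_t /derive /derive1; case: z => t x /=.
set d := (fun _ : _ => _); set d' := (fun _ : _ => _); suff -> : d = d' by [].
apply/funext => h; rewrite /d /d' /=; congr (_ *: (phi _ - _)).
by congr pair; rewrite /= /GRing.scale /= ?mulr1 ?mulr0 ?add0r.
Qed.

Lemma partial_xE (phi : R * R -> R) z :
  partial_x phi z = derive1 (fun x => phi (z.1, x)) z.2.
Proof.
rewrite /partial_x /derive /derive1; case: z => t x /=.
set d := (fun _ : _ => _); set d' := (fun _ : _ => _); suff -> : d = d' by [].
apply/funext => h; rewrite /d /d' /=; congr (_ *: (phi _ - _)).
by congr pair; rewrite /= /GRing.scale /= ?mulr1 ?mulr0 ?add0r.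
Qed.

Lemma differentiable_line_t (phi : R * R -> R) (t x : R) :
  differentiable phi (t, x) -> derivable (fun t => phi (t, x)) t 1.
Proof.
move=> dphi; apply/derivable1_diffP.
apply: (@differentiable_comp _ _ _ _ (fun t : R => (t, x)) phi) => //.
Qed.

Lemma differentiable_line_x (phi : R * R -> R) (t x : R) :
  differentiable phi (t, x) -> derivable (fun x => phi (t, x)) x 1.
Proof.
move=> dphi; apply/derivable1_diffP.
apply: (@differentiable_comp _ _ _ _ (fun x : R => (t, x)) phi) => //.
Qed.

Lemma Rintegral_derive1 (F f : R -> R) : continuous f ->
  (forall t, derivable F t 1 /\ derive1 F t = f t) ->
  \int[mu]_(t in `[0, M]) f t = F M - F 0.
Proof.
move=> cf dF; have cF : continuous F.
  by move=> t; apply/differentiable_continuous/derivable1_diffP; exact: (dF t).1.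
rewrite /Rintegral (@continuous_FTC2 _ f F) ?per_gt0//.
- exact: continuous_subspaceT.
- split; first by move=> t _; exact: (dF t).1.
  + by apply: cvg_at_right_filter; exact: cF.
  + by apply: cvg_at_left_filter; exact: cF.
- by move=> t _; exact: (dF t).2.
Qed.

Lemma continuous_per_integrable (f : R -> R) : continuous f ->
  mu.-integrable `[0, M] (EFin \o f).
Proof.
move=> cf; apply: continuous_compact_integrable; first exact: segment_compact.
exact: continuous_subspaceT.
Qed.

(** On each line the integral is the increment of psi over a period. *)
Lemma Rintegral_partial_t (psi : R * R -> R) : torus_periodic psi ->
  (forall z, differentiable psi z) -> continuous (partial_t psi) ->
  \int[leb2]_(z in cell) partial_t psi z = 0.
Proof.
move=> ppsi dpsi cpsi; apply: Rintegral_cell_t0.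
- exact: continuous_cell_integrable.
- move=> x; rewrite (@Rintegral_derive1 (fun t => psi (t, x)) (fun t => partial_t psi (t, x))).
  + by have [] := ppsi 0 x; rewrite add0r => -> _; rewrite subrr.
  + exact: continuous_line_t.
  + by move=> t; rewrite partial_tE; split => //; exact: differentiable_line_t.
- by move=> x; apply: continuous_per_integrable; exact: continuous_line_t.
Qed.

Lemma Rintegral_partial_x (psi : R * R -> R) : torus_periodic psi ->
  (forall z, differentiable psi z) -> continuous (partial_x psi) ->
  \int[leb2]_(z in cell) partial_x psi z = 0.
Proof.
move=> ppsi dpsi cpsi; apply: Rintegral_cell_x0.
- exact: continuous_cell_integrable.
- move=> t; rewrite (@Rintegral_derive1 (fun x => psi (t, x)) (fun x => partial_x psi (t, x))).
  + by have [_] := ppsi t 0; rewrite add0r => ->; rewrite subrr.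
  + exact: continuous_line_x.
  + by move=> x; rewrite partial_xE; split => //; exact: differentiable_line_x.
- by move=> t; apply: continuous_per_integrable; exact: continuous_line_x.
Qed.

End TorusIntegration.

(** * Primitives on the line and the periodic primitive of a - a_0 *)

Section Primitive.
Context {R : realType}.
Notation mu := (@lebesgue_measure R).
Notation M := (pi *+ 2 : R).

(** An integral from a fixed base point is a primitive only to the right of it. The integrals from
    -n, normalised to vanish at 0, agree wherever n > |t| and glue together. *)
Lemma continuous_primitive (b : R -> R) : continuous b ->
  exists B : R -> R, forall t, derivable B t 1 /\ derive1 B t = b t.
Proof.
move=> cb.
have ib (x y : R) : mu.-integrable `[x, y] (EFin \o b).
  apply: continuous_compact_integrable; first exact: segment_compact.
  exact: continuous_subspaceT.
pose F (n : nat) (t : R) : R := \int[mu]_(s in `[- n%:R, t]) b s.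
have Fnm (n m : nat) t : (n <= m)%N -> - n%:R <= t ->
    F m t - F m (- n%:R) = F n t.
  move=> nm nt; rewrite /F (Rintegral_itvB (ib _ _)) ?bnd_simp//; last by rewrite lerN2 ler_nat.
  by rewrite Rintegral_itv_obnd_cbnd//; apply: integrableS (ib (- n%:R) t) => //;
    exact: subset_itv_oc_cc.
pose N (t : R) : nat := (Num.truncn `|t|).+1.
have NP t : `|t| < (N t)%:R by exact: truncnS_gt.
pose B t := F (N t) t - F (N t) 0.
have BF (n : nat) t : `|t| < n%:R -> B t = F n t - F n 0.
  have H i j s : (i <= j)%N -> `|s| < i%:R -> F i s - F i 0 = F j s - F j 0.
    move=> ij si; have [s1 s2] : - i%:R <= s /\ s <= i%:R.
      by move: (ltW si); rewrite ler_norml => /andP[].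
    rewrite -(Fnm i j s)// -(Fnm i j 0)// ?oppr_le0//; ring.
  move=> tn; case: (leqP (N t) n) => [Nn|/ltnW nN]; first exact: H.
  by apply/esym; exact: H.
exists B => t.
(* One more than [N t], so that the same n serves all points at distance less than 1 from t. *)
pose n : nat := (N t).+1.
have tn : `|t| < n%:R by rewrite (lt_trans (NP t))// ltr_nat.
have [h1 h2] : derivable (F n) t 1 /\ derive1 (F n) t = b t.
  apply: (@continuous_FTC1_closed _ b (- n%:R) t (t + 1)) => //.
  - by rewrite ltrDl.
  - by move: tn; rewrite ltr_norml => /andP[].
  - exact: cb.
have nB : \forall s \near t, F n s - F n 0 = B s.
  near=> s; apply/esym/BF.
  have st : `|s - t| < 1.
    by near: s; apply/nbhs_ballP; exists 1 => //= y; rewrite /ball/= distrC.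
  have -> : s = (s - t) + t by rewrite subrK.
  rewrite (le_lt_trans (ler_normD _ _))// /n -natr1 addrC ltrD//.
have dF : is_derive t (1 : R) (fun s => F n s - F n 0) (b t).
  rewrite -[b t]subr0 -h2 derive1E.
  by apply: is_deriveB; apply: derivableP.
have dB : is_derive t (1 : R) B (b t) := near_eq_is_derive nB dF.
by split; [exact: ex_derive|rewrite derive1E derive_val].
Unshelve. all: by end_near. Qed.

(** The increment of A over a period has zero derivative, and its value at 0 is the integral of a
    minus its mean, which vanishes. *)
Lemma circle_primitive (a : R -> R) : continuous a -> periodic a M ->
  exists A : R -> R, (forall t, derivable A t 1 /\ derive1 A t = a t - circle_mean a)
    /\ periodic A M.
Proof.
move=> ca pa.
have cb : continuous (fun t => a t - circle_mean a).
  by move=> t; apply: cvgB; [exact: ca|exact: cvg_cst].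
have [A dA] := continuous_primitive cb; exists A; split => // t.
have dAi s : is_derive s (1 : R) A (a s - circle_mean a).
  by rewrite -(dA s).2 derive1E; apply: derivableP; exact: (dA s).1.
have dS s : is_derive s (1 : R) (fun s => A (s + M) - A s) 0.
  have -> : 0 = (1 : R) * (a (s + M) - circle_mean a) - (a s - circle_mean a) by rewrite pa; ring.
  apply: is_deriveB.
  have dsh : is_derive s (1 : R) (fun s => s + M) 1.
    by rewrite -[X in is_derive _ _ _ X]addr0; apply: is_deriveD.
  by have := @is_derive1_comp _ A (fun s => s + M) s _ 1 (dAi (s + M)) dsh; rewrite mul1r mulr1.
have := @is_derive_0_is_cst _ _ t 0 dS.
rewrite add0r -(Rintegral_derive1 cb)//.
have -> : \int[mu]_(s in `[0, M]) (a s - circle_mean a) = 0.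
  rewrite RintegralB//; [|exact: continuous_per_integrable|]; last first.
    by apply: (@continuous_per_integrable _ (fun=> _)) => ?; exact: cvg_cst.
  rewrite Rintegral_cst// /= lebesgue_measure_itv /= lte_fin per_gt0 sube0 /=.
  rewrite /circle_mean mulrAC mulVf ?mul1r ?subrr// gt_eqF//; exact: per_gt0.
by move/eqP; rewrite subr_eq0 => /eqP.
Qed.

End Primitive.

(** * Twisted waves and the smooth algebra that they generate with a *)

Lemma cosD_int (R : realType) (u : R) (l : int) : cos (u + l%:~R * (pi *+ 2)) = cos u.
Proof.
case: l => n; first by rewrite -[n%:~R]/(n%:R) mulr_natl; exact: (periodicn (@cosD2pi R)).
rewrite NegzE mulrNz mulNr -[in RHS](subrK (n.+1%:R * (pi *+ 2)) u) mulr_natl.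
exact/esym/(periodicn (@cosD2pi R)).
Qed.

Lemma sinD_int (R : realType) (u : R) (l : int) : sin (u + l%:~R * (pi *+ 2)) = sin u.
Proof.
case: l => n; first by rewrite -[n%:~R]/(n%:R) mulr_natl; exact: (periodicn (@sinD2pi R)).
rewrite NegzE mulrNz mulNr -[in RHS](subrK (n.+1%:R * (pi *+ 2)) u) mulr_natl.
exact/esym/(periodicn (@sinD2pi R)).
Qed.

Section Twisted.
Context {R : realType}.
Notation M := (pi *+ 2 : R).
Variables (a A : R -> R) (alpha : R).
Hypothesis ha : smooth_circle a.
Hypothesis dA : forall t, derivable A t 1 /\ derive1 A t = a t - alpha.
Hypothesis pA : periodic A M.

(* [cos (theta j)] and [sin (theta j)] are the real and imaginary parts of the eigenfunctions
   exp(i(l t + k(x - A t))) of [partial_t + a partial_x], with eigenvalue i(l + k alpha). *)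
Definition theta (j : int * int) (z : R * R) : R :=
  j.1%:~R * z.1 + j.2%:~R * (z.2 - A z.1).

(* An algebra of smooth functions stable under both partial derivatives, containing the test
   functions [a cos (theta j)] and [a sin (theta j)]. *)
Inductive tw : (R * R -> R) -> Prop :=
| tw_cst c : tw (fun=> c)
| tw_coef n : tw (fun z => derive1n n a z.1)
| tw_cos j : tw (fun z => cos (theta j z))
| tw_sin j : tw (fun z => sin (theta j z))
| tw_add p q : tw p -> tw q -> tw (fun z => p z + q z)
| tw_mul p q : tw p -> tw q -> tw (fun z => p z * q z).

Lemma tw_scale c p : tw p -> tw (fun z => c * p z).
Proof. by move=> tp; apply: tw_mul => //; exact: tw_cst. Qed.

Lemma periodic_derive1n n : periodic (derive1n n a) M.
Proof.
elim: n => [|n IH] t; first exact: ha.1.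
rewrite derive1nS /derive1.
set d := (fun _ : _ => _); set d' := (fun _ : _ => _); suff -> : d = d' by [].
by apply/funext => h; rewrite /d /d' /= addrA !IH.
Qed.

Lemma tw_periodic p : tw p -> torus_periodic p.
Proof.
elim=> [c|n|j|j|{}p q _ IHp _ IHq|{}p q _ IHp _ IHq] t x /=.
- by [].
- by rewrite periodic_derive1n.
- rewrite /theta /= pA; split.
    rewrite -[in RHS](cosD_int _ j.1); congr cos; ring.
  rewrite -[in RHS](cosD_int _ j.2); congr cos; ring.
- rewrite /theta /= pA; split.
    rewrite -[in RHS](sinD_int _ j.1); congr sin; ring.
  rewrite -[in RHS](sinD_int _ j.2); congr sin; ring.
- by have [-> ->] := IHp t x; have [-> ->] := IHq t x.
- by have [-> ->] := IHp t x; have [-> ->] := IHq t x.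
Qed.

Lemma differentiable_fst (z : R * R) : differentiable (fst : R * R -> R) z.
Proof. by apply: linear_differentiable => ?; exact: cvg_fst. Qed.

Lemma differentiable_snd (z : R * R) : differentiable (snd : R * R -> R) z.
Proof. by apply: linear_differentiable => ?; exact: cvg_snd. Qed.

Lemma differentiable_fst_comp (h : R -> R) (z : R * R) : derivable h z.1 1 ->
  differentiable (fun z : R * R => h z.1) z.
Proof.
move=> dh; apply: (@differentiable_comp _ _ _ _ (fst : R * R -> R) h) => //.
  exact: differentiable_fst.
exact/derivable1_diffP.
Qed.

Lemma differentiable_theta j z : differentiable (theta j) z.
Proof.
pose f : R * R -> R := fst; pose g : R * R -> R := snd; pose h (z : R * R) : R := A z.1.
have -> : theta j = j.1%:~R *: f + j.2%:~R *: (g - h) by [].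
have dg : differentiable g z := differentiable_snd z.
have df : differentiable f z := differentiable_fst z.
have dh : differentiable h z by apply: differentiable_fst_comp; exact: (dA _).1.
by apply: differentiableD; apply: differentiableZ => //; exact: differentiableB.
Qed.

Lemma differentiable_theta_comp (h : R -> R) j z : (forall t, derivable h t 1) ->
  differentiable (fun z => h (theta j z)) z.
Proof.
move=> dh; apply: (@differentiable_comp _ _ _ _ (theta j) h).
  exact: differentiable_theta.
exact/derivable1_diffP.
Qed.

Lemma tw_differentiable p : tw p -> forall z, differentiable p z.
Proof.
elim=> [c|n|j|j|{}p q _ IHp _ IHq|{}p q _ IHp _ IHq] z /=.
- exact: differentiable_cst.
- exact: differentiable_fst_comp (ha.2 n _).
- by apply: differentiable_theta_comp; exact: derivable_cos.
- by apply: differentiable_theta_comp; exact: derivable_sin.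
- exact: differentiableD.
- exact: differentiableM.
Qed.

Lemma tw_continuous p : tw p -> continuous p.
Proof. by move=> tp z; apply/differentiable_continuous/tw_differentiable. Qed.

(** The variable term -k a(t) is what a(t) times the x-derivative k cancels, leaving the constant l
    + k alpha. *)
Lemma is_derive_theta_t j t x :
  is_derive t (1 : R) (fun t => theta j (t, x)) (j.1%:~R - j.2%:~R * (a t - alpha)).
Proof.
have dAt : is_derive t (1 : R) A (a t - alpha).
  by rewrite -(dA t).2 derive1E; apply: derivableP; exact: (dA t).1.
rewrite (_ : _ - _ = j.1%:~R *: 1 + j.2%:~R *: (0 - (a t - alpha))); last first.
  by rewrite /GRing.scale /=; ring.
have h1 : is_derive t (1 : R) (fun t => j.1%:~R * t) (j.1%:~R *: 1) by exact: is_deriveZ.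
have h2 : is_derive t (1 : R) (fun t => x - A t) (0 - (a t - alpha)) by exact: is_deriveB.
have h3 : is_derive t (1 : R) (fun t => j.2%:~R * (x - A t)) (j.2%:~R *: (0 - (a t - alpha))).
  exact: is_deriveZ.
exact: (is_deriveD h1 h3).
Qed.

Lemma is_derive_theta_x j t x : is_derive x (1 : R) (fun x => theta j (t, x)) (j.2%:~R).
Proof.
rewrite (_ : j.2%:~R = 0 + j.2%:~R *: (1 - 0)); last by rewrite /GRing.scale /=; ring.
have h2 : is_derive x (1 : R) (fun x => x - A t) (1 - 0) by exact: is_deriveB.
have h3 : is_derive x (1 : R) (fun x => j.2%:~R * (x - A t)) (j.2%:~R *: (1 - 0)).
  exact: is_deriveZ.
exact: (is_deriveD (is_derive_cst (j.1%:~R * t : R) x 1) h3).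
Qed.

Lemma partial_t_theta (h h' : R -> R) j : (forall s, is_derive s (1 : R) h (h' s)) ->
  partial_t (fun z => h (theta j z)) =
  fun z => h' (theta j z) * (j.1%:~R - j.2%:~R * (a z.1 - alpha)).
Proof.
move=> dh; apply/funext => -[t x]; rewrite partial_tE derive1E /=.
have := @is_derive1_comp _ h (fun t => theta j (t, x)) t _ _ (dh _) (is_derive_theta_t j t x).
by move=> H; rewrite (@derive_val _ _ _ _ _ _ _ H).
Qed.

Lemma partial_x_theta (h h' : R -> R) j : (forall s, is_derive s (1 : R) h (h' s)) ->
  partial_x (fun z => h (theta j z)) = fun z => h' (theta j z) * j.2%:~R.
Proof.
move=> dh; apply/funext => -[t x]; rewrite partial_xE derive1E /=.
have := @is_derive1_comp _ h (fun x => theta j (t, x)) x _ _ (dh _) (is_derive_theta_x j t x).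
by move=> H; rewrite (@derive_val _ _ _ _ _ _ _ H).
Qed.

Lemma partial_t_cos j : partial_t (fun z => cos (theta j z)) =
  fun z => - sin (theta j z) * (j.1%:~R - j.2%:~R * (a z.1 - alpha)).
Proof. by apply: (@partial_t_theta cos (fun s => - sin s)) => s; exact: is_derive_cos. Qed.

Lemma partial_t_sin j : partial_t (fun z => sin (theta j z)) =
  fun z => cos (theta j z) * (j.1%:~R - j.2%:~R * (a z.1 - alpha)).
Proof. by apply: partial_t_theta => s; exact: is_derive_sin. Qed.

Lemma partial_x_cos j : partial_x (fun z => cos (theta j z)) =
  fun z => - sin (theta j z) * j.2%:~R.
Proof. by apply: (@partial_x_theta cos (fun s => - sin s)) => s; exact: is_derive_cos. Qed.

Lemma partial_x_sin j : partial_x (fun z => sin (theta j z)) =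
  fun z => cos (theta j z) * j.2%:~R.
Proof. by apply: partial_x_theta => s; exact: is_derive_sin. Qed.

Lemma partialD (v : R * R) (p q : R * R -> R) : (forall z, differentiable p z) ->
  (forall z, differentiable q z) ->
  (fun z => 'D_v (fun z => p z + q z) z) = fun z => 'D_v p z + 'D_v q z.
Proof. by move=> dp dq; apply/funext => z; rewrite -deriveD//; exact: diff_derivable. Qed.

Lemma partialM (v : R * R) (p q : R * R -> R) : (forall z, differentiable p z) ->
  (forall z, differentiable q z) ->
  (fun z => 'D_v (fun z => p z * q z) z) = fun z => p z * 'D_v q z + q z * 'D_v p z.
Proof.
move=> dp dq; apply/funext => z.
by rewrite (@deriveM _ _ p q z v)//; exact: diff_derivable.
Qed.

Lemma partial_x_fst (h : R -> R) : partial_x (fun z : R * R => h z.1) = fun=> 0.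
Proof. by apply/funext => z; rewrite partial_xE /= derive1_cst. Qed.

Lemma partial_t_fst (h : R -> R) : partial_t (fun z : R * R => h z.1) = fun z => derive1 h z.1.
Proof. by apply/funext => z; rewrite partial_tE. Qed.

Lemma tw_a : tw (fun z => a z.1).
Proof. exact: (tw_coef 0). Qed.

Lemma tw_freq j : tw (fun z => j.1%:~R - j.2%:~R * (a z.1 - alpha)).
Proof.
rewrite (_ : (fun z => _) = (fun z => (j.1%:~R + j.2%:~R * alpha) + (- j.2%:~R) * a z.1)).
  apply: tw_add; first exact: tw_cst.
  by apply: tw_scale; exact: tw_a.
by apply/funext => z; ring.
Qed.

Lemma tw_N p : tw p -> tw (fun z => - p z).
Proof.
move=> /(tw_scale (-1)); rewrite (_ : (fun z => -1 * p z) = (fun z => - p z))//.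
by apply/funext => z; rewrite mulN1r.
Qed.

Lemma tw_partial p : tw p -> tw (partial_t p) /\ tw (partial_x p).
Proof.
elim=> [c|n|j|j|{}p q tp [IHp IHp'] tq [IHq IHq']|{}p q tp [IHp IHp'] tq [IHq IHq']] /=.
- rewrite (@partial_x_fst (fun=> c)) (@partial_t_fst (fun=> c)).
  rewrite (_ : (fun z : R * R => derive1 (fun=> c) z.1) = fun=> 0).
    by split; exact: tw_cst.
  by apply/funext => z; exact: derive1_cst.
- rewrite (@partial_x_fst (derive1n n a)) (@partial_t_fst (derive1n n a)).
  by split; [exact: (tw_coef n.+1)|exact: tw_cst].
- rewrite partial_t_cos partial_x_cos; split.
    by apply: tw_mul; [apply: tw_N; exact: tw_sin|exact: tw_freq].
  by apply: tw_mul; [apply: tw_N; exact: tw_sin|exact: tw_cst].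
- rewrite partial_t_sin partial_x_sin; split.
    by apply: tw_mul; [exact: tw_cos|exact: tw_freq].
  by apply: tw_mul; [exact: tw_cos|exact: tw_cst].
- have dp := tw_differentiable tp; have dq := tw_differentiable tq.
  rewrite /partial_t /partial_x !partialD//.
  by split; apply: tw_add.
- have dp := tw_differentiable tp; have dq := tw_differentiable tq.
  rewrite /partial_t /partial_x !partialM//.
  by split; apply: tw_add; apply: tw_mul.
Qed.

Lemma tw_smooth p : tw p -> smooth_torus p.
Proof.
move=> tp; split; first exact: tw_periodic.
move=> s; suff : tw (foldr (fun b => if b then partial_t else partial_x) p s).
  by move/tw_differentiable.
by elim: s => [//|[] s IH] /=; have [] := tw_partial IH.
Qed.

End Twisted.

(** * Orthogonality and density of the twisted waves *)

Section TwistedDensity.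
Context {R : realType}.
Notation M := (pi *+ 2 : R).
Notation RR := (measurableTypeR R * measurableTypeR R)%type.
Notation leb2 := (@lebesgue2 R).
Notation cell := (@torus_cell R).
Variables (a A : R -> R) (alpha : R).
Hypothesis ha : smooth_circle a.
Hypothesis dA : forall t, derivable A t 1 /\ derive1 A t = a t - alpha.
Hypothesis pA : periodic A M.
Notation theta := (theta A).
Notation sqint := (@sqint _ RR R leb2 cell).
Notation ip := (@ip _ RR R leb2 cell).

Lemma thetaD i j z : theta (i + j) z = theta i z + theta j z.
Proof. by rewrite /theta /= !intrD; ring. Qed.

Lemma thetaN j z : theta (- j) z = - theta j z.
Proof. by rewrite /theta /= !mulrNz; ring. Qed.

Lemma theta0 z : theta 0 z = 0.
Proof. by rewrite /theta /=; ring. Qed.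

Lemma continuous_sqint (f : R * R -> R) : continuous f -> sqint f.
Proof.
move=> cf; split; first exact: continuous2_measurable.
apply: (@continuous_cell_integrable R (fun z => f z ^+ 2)).
by move=> z; apply: continuousM; exact: cf.
Qed.

Lemma tw_sqint p : tw a A p -> sqint p.
Proof. by move=> tp; apply: continuous_sqint; exact: tw_continuous tp. Qed.

Lemma tw_integrable p : tw a A p -> leb2.-integrable cell (fun z => (p z)%:E).
Proof. by move=> tp; apply: continuous_cell_integrable; exact: tw_continuous tp. Qed.

Lemma tw_Rintegral_t p : tw a A p -> \int[leb2]_(z in cell) partial_t p z = 0.
Proof.
move=> tp; apply: Rintegral_partial_t.
- exact: tw_periodic tp.
- exact: tw_differentiable tp.
- by apply: tw_continuous (tw_partial ha dA tp).1.
Qed.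

Lemma tw_Rintegral_x p : tw a A p -> \int[leb2]_(z in cell) partial_x p z = 0.
Proof.
move=> tp; apply: Rintegral_partial_x.
- exact: tw_periodic tp.
- exact: tw_differentiable tp.
- by apply: tw_continuous (tw_partial ha dA tp).2.
Qed.

Lemma intr_neq0 (k : int) : k != 0 -> k%:~R != 0 :> R.
Proof. by rewrite intr_eq0. Qed.

(** A nonconstant wave is a partial derivative, of sin(theta) / k in x when k is nonzero and of
    sin(theta) / l in t when k = 0, where the twist is absent; such derivatives integrate to 0. *)
Lemma Rintegral_cos j : \int[leb2]_(z in cell) cos (theta j z) = if j == 0 then M ^+ 2 else 0.
Proof.
have [->|j0] := eqVneq j 0.
  rewrite (@eq_Rintegral _ _ _ _ _ (fun=> 1)); last by move=> z _; rewrite theta0 cos0.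
  rewrite Rintegral_cst; last exact: measurable_cell.
  by rewrite mul1r [X in fine X](_ : _ = (M ^+ 2)%:E)//; exact: lebesgue2_cell.
case: j j0 => l k; have [->|k0] := eqVneq k 0.
  move=> lk; have l0 : l != 0 by apply: contra lk => /eqP ->.
  have := tw_Rintegral_t (tw_scale (l%:~R^-1) (tw_sin a A (l, 0))).
  rewrite (_ : partial_t _ = fun z => l%:~R^-1 * partial_t (fun z => sin (theta (l, 0) z)) z).
    rewrite (partial_t_sin dA)/= => H; rewrite -[RHS]H; apply: eq_Rintegral => z _.
    rewrite mul0r subr0 mulrCA mulVf ?mulr1//; exact: intr_neq0.
  apply/funext => z; rewrite /partial_t (@deriveZ _ _ _ (fun z => sin (theta (l, 0) z)))//.
  exact/diff_derivable/(tw_differentiable ha dA (tw_sin a A _)).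
move=> _; have := tw_Rintegral_x (tw_scale (k%:~R^-1) (tw_sin a A (l, k))).
rewrite (_ : partial_x _ = fun z => k%:~R^-1 * partial_x (fun z => sin (theta (l, k) z)) z).
  rewrite (partial_x_sin A)/= => H; rewrite -[RHS]H; apply: eq_Rintegral => z _.
  rewrite mulrCA mulVf ?mulr1//; exact: intr_neq0.
apply/funext => z; rewrite /partial_x (@deriveZ _ _ _ (fun z => sin (theta (l, k) z)))//.
exact/diff_derivable/(tw_differentiable ha dA (tw_sin a A _)).
Qed.

Lemma Rintegral_sin j : \int[leb2]_(z in cell) sin (theta j z) = 0.
Proof.
have [->|j0] := eqVneq j 0.
  rewrite (@eq_Rintegral _ _ _ _ _ (fun=> 0)); last by move=> z _; rewrite theta0 sin0.
  by rewrite Rintegral_cst ?mul0r//; exact: measurable_cell.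
case: j j0 => l k; have [->|k0] := eqVneq k 0.
  move=> lk; have l0 : l != 0 by apply: contra lk => /eqP ->.
  have := tw_Rintegral_t (tw_scale (- l%:~R^-1) (tw_cos a A (l, 0))).
  rewrite (_ : partial_t _ = fun z => - l%:~R^-1 * partial_t (fun z => cos (theta (l, 0) z)) z).
    rewrite (partial_t_cos dA)/= => H; rewrite -[RHS]H; apply: eq_Rintegral => z _.
    rewrite mul0r subr0 !(mulNr, mulrN) opprK mulrCA mulVf ?mulr1//; exact: intr_neq0.
  apply/funext => z; rewrite /partial_t (@deriveZ _ _ _ (fun z => cos (theta (l, 0) z)))//.
  exact/diff_derivable/(tw_differentiable ha dA (tw_cos a A _)).
move=> _; have := tw_Rintegral_x (tw_scale (- k%:~R^-1) (tw_cos a A (l, k))).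
rewrite (_ : partial_x _ = fun z => - k%:~R^-1 * partial_x (fun z => cos (theta (l, k) z)) z).
  rewrite (partial_x_cos A)/= => H; rewrite -[RHS]H; apply: eq_Rintegral => z _.
  rewrite !(mulNr, mulrN) opprK mulrCA mulVf ?mulr1//; exact: intr_neq0.
apply/funext => z; rewrite /partial_x (@deriveZ _ _ _ (fun z => cos (theta (l, k) z)))//.
exact/diff_derivable/(tw_differentiable ha dA (tw_cos a A _)).
Qed.

(** Product-to-sum formula. The term for i + j = 0 appears because opposite frequencies give the
    same cosine; this is why half of the lattice suffices. *)
Lemma ip_cos_cos i j : ip (fun z => cos (theta i z)) (fun z => cos (theta j z)) =
  2^-1 * ((if i - j == 0 then M ^+ 2 else 0) + (if i + j == 0 then M ^+ 2 else 0)).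
Proof.
rewrite -!Rintegral_cos -RintegralD //;
  [|exact: measurable_cell|exact: (tw_integrable (tw_cos a A _))..].
rewrite -RintegralZl;
  [|exact: measurable_cell|exact: (tw_integrable (tw_add (tw_cos a A _) (tw_cos a A _)))].
apply: eq_Rintegral => z _; rewrite !thetaD thetaN; move: (theta i z) (theta j z) => x y;
  rewrite !cosD cosN sinN; by field.
Qed.

Lemma ip_sin_sin i j : ip (fun z => sin (theta i z)) (fun z => sin (theta j z)) =
  2^-1 * ((if i - j == 0 then M ^+ 2 else 0) - (if i + j == 0 then M ^+ 2 else 0)).
Proof.
rewrite -!Rintegral_cos -RintegralB //;
  [|exact: measurable_cell|exact: (tw_integrable (tw_cos a A _))..].
rewrite -RintegralZl;
  [|exact: measurable_cell|exact: (tw_integrable (tw_add (tw_cos a A _) (tw_N (tw_cos a A _))))].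
apply: eq_Rintegral => z _; rewrite !thetaD thetaN; move: (theta i z) (theta j z) => x y;
  rewrite !cosD cosN sinN; by field.
Qed.

Lemma ip_cos_sin i j : ip (fun z => cos (theta i z)) (fun z => sin (theta j z)) = 0.
Proof.
transitivity (2^-1 * (\int[leb2]_(z in cell) sin (theta (i + j) z) -
   \int[leb2]_(z in cell) sin (theta (i - j) z))); last by rewrite !Rintegral_sin subrr mulr0.
rewrite -RintegralB //; [|exact: measurable_cell|exact: (tw_integrable (tw_sin a A _))..].
rewrite -RintegralZl;
  [|exact: measurable_cell|exact: (tw_integrable (tw_add (tw_sin a A _) (tw_N (tw_sin a A _))))].
apply: eq_Rintegral => z _; rewrite !thetaD thetaN; move: (theta i z) (theta j z) => x y;
  rewrite !sinD cosN sinN; by field.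
Qed.

(** The real span of the waves, without the coefficients allowed in [tw]: approximants must lie in
    the span of the basis and be bounded on the whole plane. *)
Inductive trig : (R * R -> R) -> Prop :=
| trig_cos j : trig (fun z => cos (theta j z))
| trig_sin j : trig (fun z => sin (theta j z))
| trig_add p q : trig p -> trig q -> trig (fun z => p z + q z)
| trig_scale c p : trig p -> trig (fun z => c * p z).

Lemma trig_tw p : trig p -> tw a A p.
Proof.
elim=> [j|j|{}p q _ IHp _ IHq|c {}p _ IHp].
- exact: tw_cos.
- exact: tw_sin.
- exact: tw_add.
- exact: tw_scale.
Qed.

Lemma trig_bdd p : trig p -> @bdd_fun _ RR R p.
Proof.
move=> tp; split; first by apply: continuous2_measurable; exact: tw_continuous (trig_tw tp).
elim: tp => [j|j|{}p q _ [K pK] _ [L qL]|c {}p _ [K pK]].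
- by exists 1 => z; exact: cos_max.
- by exists 1 => z; exact: sin_max.
- by exists (K + L) => z; rewrite (le_trans (ler_normD _ _))// lerD.
- by exists (`|c| * K) => z; rewrite normrM ler_wpM2l.
Qed.

Lemma trig_cst c : trig (fun=> c).
Proof.
rewrite (_ : (fun _ => c) = fun z => c * cos (theta 0 z)); first exact/trig_scale/trig_cos.
by apply/funext => z; rewrite theta0 cos0 mulr1.
Qed.

Lemma trig_half p q c : trig p -> trig q -> trig (fun z => 2^-1 * (p z + c * q z)).
Proof. by move=> tp tq; apply/trig_scale/trig_add => //; exact: trig_scale. Qed.

(** Product-to-sum formulas keep products of waves in the span. *)
Lemma trig_mul p q : trig p -> trig q -> trig (fun z => p z * q z).
Proof.
move=> tp; elim: tp q => [i|i|{}p p' _ IHp _ IHp'|c {}p _ IHp] q tq.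
- elim: tq => [j|j|{}q q' _ IHq _ IHq'|c {}q _ IHq].
  + have := trig_half 1 (trig_cos (i - j)) (trig_cos (i + j)).
    by congr trig; apply/funext => z; rewrite !thetaD thetaN;
      move: (theta i z) (theta j z) => x y; rewrite !cosD cosN sinN; by field.
  + have := trig_half (-1) (trig_sin (i + j)) (trig_sin (i - j)).
    by congr trig; apply/funext => z; rewrite !thetaD thetaN;
      move: (theta i z) (theta j z) => x y; rewrite !sinD cosN sinN; by field.
  + by have := trig_add IHq IHq'; congr trig; apply/funext => z; ring.
  + by have := trig_scale c IHq; congr trig; apply/funext => z; ring.
- elim: tq => [j|j|{}q q' _ IHq _ IHq'|c {}q _ IHq].
  + have := trig_half 1 (trig_sin (i + j)) (trig_sin (i - j)).
    by congr trig; apply/funext => z; rewrite !thetaD thetaN;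
      move: (theta i z) (theta j z) => x y; rewrite !sinD cosN sinN; by field.
  + have := trig_half (-1) (trig_cos (i - j)) (trig_cos (i + j)).
    by congr trig; apply/funext => z; rewrite !thetaD thetaN;
      move: (theta i z) (theta j z) => x y; rewrite !cosD cosN sinN; by field.
  + by have := trig_add IHq IHq'; congr trig; apply/funext => z; ring.
  + by have := trig_scale c IHq; congr trig; apply/funext => z; ring.
- by have := trig_add (IHp _ tq) (IHp' _ tq); congr trig; apply/funext => z; ring.
- by have := trig_scale c (IHp _ tq); congr trig; apply/funext => z; ring.
Qed.

Notation L2cl := (@L2cl _ RR R leb2 cell trig).
Notation L2set := (@L2set _ RR R leb2 cell trig).
Let mC := @measurable_cell R.
Let mCy := @cell_lty R.
Let tD := L2clD mC mCy trig_bdd trig_add.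
Let tM := L2clM mC mCy trig_bdd trig_mul.
Let tB := L2clB mC mCy trig_bdd trig_cst trig_add trig_mul.
Let tZ := L2clZ mC mCy trig_bdd trig_cst trig_mul.
Let tlt := L2set_lt mC mCy trig_bdd trig_cst trig_add trig_mul.
Let tae := L2set_ae mC mCy trig_bdd.
Let tI := L2set_setI mC mCy trig_bdd trig_mul.
Let tC := L2set_setC mC mCy trig_bdd trig_cst trig_add trig_mul.
Let tU := L2set_setU mC mCy trig_bdd trig_cst trig_add trig_mul.
Let t0 := L2set_set0 mC mCy trig_bdd trig_cst.
Let tpre := L2set_preimage mC mCy trig_bdd trig_cst trig_add trig_mul.

(* On [0, 2 pi[ the half-lines [p < c] are cut out by the signs of [sin p] and [cos p - cos c];
   [N] is the null set where [p = 2 pi]. *)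
Lemma L2set_coord_lt (p : RR -> R) (N : set RR) : measurable_fun setT p ->
  measurable N -> leb2 N = 0%E ->
  (forall z, cell z -> 0 <= p z) -> (forall z, cell z -> ~ N z -> p z < M) ->
  L2cl (fun z => cos (p z)) -> L2cl (fun z => sin (p z)) ->
  forall c, L2set [set z | p z < c].
Proof.
move=> mp mN N0 p0 pM ccos csin c.
have mE : measurable [set z : RR | p z < c].
  have -> : [set z : RR | p z < c] = setT `&` p @^-1` `]-oo, c[.
    by apply/seteqP; split => z /=; rewrite in_itv/=; [|case].
  exact: mp.
have bcos : @bdd_fun _ RR R (fun z => cos (p z)).
  split; last by exists 1 => z; exact: cos_max.
  by apply: measurableT_comp => //; apply: continuous_measurable_fun; exact: continuous_cos.
have bsin : @bdd_fun _ RR R (fun z => sin (p z)).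
  split; last by exists 1 => z; exact: sin_max.
  by apply: measurableT_comp => //; apply: continuous_measurable_fun; exact: continuous_sin.
have bcosN : @bdd_fun _ RR R (fun z => -1 * cos (p z)) by apply: bdd_funM => //; exact: bdd_fun_cst.
have S := tC (tlt 0 csin bsin).
have pipos : 0 < pi :> R := pi_gt0 R.
have M2 : M = pi + pi by rewrite mulr2n.
have shift (t : R) : sin t = - sin (t - pi) /\ cos t = - cos (t - pi).
  by rewrite -{1 3}(subrK pi t) sinDpi cosDpi.
have sin0 (t : R) : 0 <= t -> t < M -> (0 <= sin t) = (t <= pi).
  move=> t0' tM'; case: (leP t pi) => tpi; first by apply: sin_ge0_pi; rewrite t0'.
  apply/negbTE; rewrite -ltNge (shift t).1 oppr_lt0 sin_gt0_pi//.
  by apply/andP; split; move: tM'; rewrite M2; lra.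
have [c0|c0] := leP c 0.
  apply: (tae mN N0 t0 mE) => z cz _; split => //= pc.
  by have := p0 z cz; lra.
have [cpi|cpi] := leP c pi.
  apply: (tae mN N0 (tI S (tlt (- cos c) (tZ (-1) ccos) bcosN)) mE) => z cz Nz /=.
  rewrite mulN1r ltrN2; have z0 := p0 z cz; have zM := pM z cz Nz.
  have Hs := sin0 _ z0 zM; have Hc : p z <= pi -> (cos c < cos (p z)) = (p z < c).
    by move=> zpi; rewrite ltr_cos// in_itv/= ?z0 ?zpi ?(ltW c0) ?cpi.
  split=> [[/negP]|zc]; first by rewrite -leNgt Hs => zpi; rewrite Hc.
  have zpi : p z <= pi by lra.
  by split; [apply/negP; rewrite -leNgt Hs|rewrite Hc].
(* For c beyond pi the half where the sine is nonnegative is kept entirely, and past pi the cosine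
   increases, so p < c reads cos p < cos c there. *)
have [cM|cM] := ltP c M.
  apply: (tae mN N0 (tU S (tlt (cos c) ccos bcos)) mE) => z cz Nz /=.
  have z0 := p0 z cz; have zM := pM z cz Nz; have Hs := sin0 _ z0 zM.
  have Hc : pi < p z -> (cos (p z) < cos c) = (p z < c).
    move=> zpi; rewrite (shift c).2 (shift (p z)).2 ltrN2 ltr_cos ?ltrD2r//.
      by rewrite in_itv/=; apply/andP; split; move: cM; rewrite M2; lra.
    by rewrite in_itv/=; apply/andP; split; move: zM; rewrite M2; lra.
  have [zpi|zpi] := leP (p z) pi.
    split=> _; first by apply: le_lt_trans cpi.
    by left; apply/negP; rewrite -leNgt Hs.
  split=> [[/negP|]|zc]; last by right; rewrite Hc.
    by rewrite -leNgt Hs leNgt zpi.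
  by rewrite Hc.
apply: (tae mN N0 (tC t0) mE) => z cz Nz /=; split => [_|_ []//].
exact: lt_le_trans (pM z cz Nz) cM.
Qed.

Lemma L2set_coord (p : RR -> measurableTypeR R) (N : set RR) : measurable_fun setT p ->
  measurable N -> leb2 N = 0%E ->
  (forall z, cell z -> 0 <= p z) -> (forall z, cell z -> ~ N z -> p z < M) ->
  L2cl (fun z => cos (p z)) -> L2cl (fun z => sin (p z)) ->
  forall B, measurable B -> L2set (p @^-1` B).
Proof.
move=> mp mN N0 p0 pM ccos csin B mB; apply: (@tpre (measurableTypeR R) p (@RGenInftyO.G R)).
  move=> _ [c ->]; rewrite (_ : _ @^-1` _ = [set z | p z < c]).
    exact: (L2set_coord_lt mp mN N0).
  by apply/seteqP; split => z /=; rewrite in_itv.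
suff : (@RGenInftyO.G R).-sigma.-measurable B by [].
by rewrite -(RGenInftyO.measurableE R); exact: mB.
Qed.

Lemma lebesgue_strip_t : leb2 ([set M] `*` setT) = 0%E.
Proof. by rewrite /lebesgue2 product_measure1E//= lebesgue_measure_set1 mul0e. Qed.

Lemma lebesgue_strip_x : leb2 (setT `*` [set M]) = 0%E.
Proof. by rewrite /lebesgue2 product_measure1E//= lebesgue_measure_set1 mule0. Qed.

(** The frequency (1, 0) carries no twist: its waves are cos t and sin t. *)
Lemma L2set_fst B : measurable B -> L2set ((fst : RR -> measurableTypeR R) @^-1` B).
Proof.
apply: (@L2set_coord fst ([set M] `*` setT)).
- exact: measurable_fst.
- exact: measurableX.
- exact: lebesgue_strip_t.
- by move=> [t x] [/=]; rewrite in_itv/= => /andP[].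
- move=> [t x] [/=]; rewrite in_itv/= => /andP[t0' tM'] _ /not_andP[|//] /eqP tM2.
  by rewrite lt_neqAle tM2.
- have := L2cl_A mC mCy trig_bdd (trig_cos (1, 0)); congr L2cl.
  by apply/funext => z; rewrite /theta /= mul1r mul0r addr0.
- have := L2cl_A mC mCy trig_bdd (trig_sin (1, 0)); congr L2cl.
  by apply/funext => z; rewrite /theta /= mul1r mul0r addr0.
Qed.

Lemma L2cl_fst (h : R -> R) : continuous h -> (forall t, `|h t| <= 1) ->
  L2cl (fun z => h z.1).
Proof.
move=> ch h1; have mh : measurable_fun setT (fun t => h t + 1).
  apply: (@continuous_measurable_fun R) => t.
  by apply: cvgD; [exact: ch|exact: cvg_cst].
(* The shift by 1 makes the function nonnegative, as [L2cl_comp] requires. *)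
rewrite (_ : (fun z => h z.1) = fun z => (h z.1 + 1) - 1); last by apply/funext => z; rewrite addrK.
apply: tB; last exact: (L2cl_cst mC mCy trig_bdd trig_cst).
apply: (L2cl_comp mC mCy trig_bdd trig_cst trig_add trig_mul (pi := fst : RR -> measurableTypeR R)
  (h := (fun t => h t + 1))) => //.
- exact: L2set_fst.
- by move=> t; have := h1 t; rewrite ler_norml => /andP[? _]; lra.
- apply: continuous_sqint => z /=; apply: cvgD; last exact: cvg_cst.
  by apply: continuous_comp; [exact: cvg_fst|exact: ch].
Qed.

(** The addition formulas for x = (x - A t) + A t remove the twist: cos and sin of A t are in the
    closure by [L2cl_fst], and those of x - A t are waves. *)
Lemma L2set_snd B : measurable B -> L2set ((snd : RR -> measurableTypeR R) @^-1` B).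
Proof.
have cA : continuous A by move=> t; apply/differentiable_continuous/derivable1_diffP;
  exact: (dA t).1.
have L1 : L2cl (fun z => cos (A z.1)).
  apply: (@L2cl_fst (fun t => cos (A t))) => [t|t]; last exact: cos_max.
  by apply: continuous_comp; [exact: cA|exact: continuous_cos].
have L2 : L2cl (fun z => sin (A z.1)).
  apply: (@L2cl_fst (fun t => sin (A t))) => [t|t]; last exact: sin_max.
  by apply: continuous_comp; [exact: cA|exact: continuous_sin].
have L3 := L2cl_A mC mCy trig_bdd (trig_cos (0, 1)).
have L4 := L2cl_A mC mCy trig_bdd (trig_sin (0, 1)).
have th z : theta (0, 1) z = z.2 - A z.1 by rewrite /theta /=; ring.
apply: (@L2set_coord snd (setT `*` [set M])).
- exact: measurable_snd.
- exact: measurableX.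
- exact: lebesgue_strip_x.
- by move=> [t x] [/= _]; rewrite in_itv/= => /andP[].
- move=> [t x] [/= _]; rewrite in_itv/= => /andP[t0' tM'] /not_andP[//|] /eqP tM2.
  by rewrite lt_neqAle tM2.
- have := tB (tM L3 L1 (trig_bdd (trig_cos _))) (tM L4 L2 (trig_bdd (trig_sin _))).
  by congr L2cl; apply/funext => z; rewrite th -cosD subrK.
- have := tD (tM L4 L1 (trig_bdd (trig_sin _))) (tM L3 L2 (trig_bdd (trig_cos _))).
  by congr L2cl; apply/funext => z; rewrite th -sinD subrK.
Qed.

(** Rectangles generate the product sigma-algebra and are intersections of the sets given by the two
    coordinates. *)
Lemma trig_dense u : sqint u -> L2cl u.
Proof.
apply: (L2cl_all mC mCy trig_bdd trig_cst trig_add trig_mul) => E.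
rewrite measurable_prod_measurableType; apply: (tpre (pi := id)) => _ [A1 mA1 [A2 mA2 <-]].
by have := tI (L2set_fst mA1) (L2set_snd mA2); congr L2set.
Qed.

End TwistedDensity.

(** * The orthogonal basis and the weighted energy estimate *)

Section SpectralEstimate.
Context {R : realType}.
Notation M := (pi *+ 2 : R).
Notation RR := (measurableTypeR R * measurableTypeR R)%type.
Notation leb2 := (@lebesgue2 R).
Notation cell := (@torus_cell R).
Variables (a A : R -> R) (alpha : R).
Hypothesis ha : smooth_circle a.
Hypothesis dA : forall t, derivable A t 1 /\ derive1 A t = a t - alpha.
Hypothesis pA : periodic A M.
Notation theta := (theta A).
Notation sqint := (@sqint _ RR R leb2 cell).
Notation ip := (@ip _ RR R leb2 cell).
Let mC := @measurable_cell R.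

(** Lexicographic positivity selects one of j and -j for each nonzero j. *)
Definition freq_pos (j : int * int) := (0 < j.2) || ((j.2 == 0) && (0 < j.1)).

Lemma freq_posP j : [|| freq_pos j, j == 0 | freq_pos (- j)].
Proof.
case: j => l k; rewrite /freq_pos.
have -> : ((l, k) == 0) = (l == 0) && (k == 0) by [].
rewrite /= !oppr_gt0 oppr_eq0.
by have [hk|hk|hk] := ltgtP k 0; have [hl|hl|hl] := ltgtP l 0; rewrite ?orbT.
Qed.

Lemma freq_pos_neq0 j : freq_pos j -> j != 0.
Proof. by apply: contraTneq => ->. Qed.

(** Hence i + j is never 0 for positive i and j, which removes the second term of [ip_cos_cos] and
    [ip_sin_sin]. *)
Lemma freq_posD i j : freq_pos i -> freq_pos j -> freq_pos (i + j).
Proof.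
case: i j => l k [l' k'] /orP[/= k0|/andP[/= /eqP -> l0]] /orP[/= k0'|/andP[/= /eqP -> l0']];
  rewrite /freq_pos /=.
- by rewrite addr_gt0.
- by rewrite addr0 k0.
- by rewrite add0r k0'.
- by rewrite addr_gt0.
Qed.

(** At frequency 0 only the cosine, the constant 1, is kept, since the sine is the zero function. *)
Definition basis_index (i : (int * int) * bool) := freq_pos i.1 || (i == (0, true)).

Definition basis (i : (int * int) * bool) (z : R * R) : R :=
  if i.2 then cos (theta i.1 z) else sin (theta i.1 z).

Lemma basis_sqint i : sqint (basis i).
Proof.
by case: i => j [];
  [exact: (tw_sqint ha dA (tw_cos a A j))|exact: (tw_sqint ha dA (tw_sin a A j))].
Qed.

Lemma M2_gt0 : 0 < M ^+ 2.
Proof. by rewrite exprn_gt0// per_gt0. Qed.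

Lemma ip_basis_pos j b : freq_pos j -> ip (basis (j, b)) (basis (j, b)) = 2^-1 * M ^+ 2.
Proof.
move=> pj; have jj : j + j == 0 = false by apply/negbTE/freq_pos_neq0/freq_posD.
case: b; rewrite /basis /=.
  by rewrite (ip_cos_cos ha dA pA) subrr eqxx jj addr0.
by rewrite (ip_sin_sin ha dA pA) subrr eqxx jj subr0.
Qed.

Lemma ip_basis_gt0 i : basis_index i -> 0 < ip (basis i) (basis i).
Proof.
case: i => j b /orP[/= pj|/eqP ->]; first by rewrite ip_basis_pos// mulr_gt0 ?invr_gt0 ?M2_gt0.
rewrite /basis /= (ip_cos_cos ha dA pA).
by rewrite mulr_gt0 ?invr_gt0// addr_gt0// M2_gt0.
Qed.

Lemma ip_basis_orth i i' : basis_index i -> basis_index i' -> i != i' ->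
  ip (basis i) (basis i') = 0.
Proof.
have E (j j' : int * int) : freq_pos j || (j == 0) -> freq_pos j' || (j' == 0) -> j != j' ->
    (j - j' == 0) = false /\ (j + j' == 0) = false.
  move=> pj pj' jj'; split; first by rewrite subr_eq0; exact: negbTE.
  case/orP: pj jj' => [pj|/eqP ->]; case/orP: pj' => [pj'|/eqP ->] jj'.
  - exact/negbTE/freq_pos_neq0/freq_posD.
  - by rewrite addr0; exact: negbTE.
  - by rewrite add0r eq_sym; exact: negbTE.
  - by rewrite eqxx in jj'.
have B j b : basis_index (j, b) -> freq_pos j || (j == 0).
  by case/orP => [/= ->//|/eqP[-> _]]; rewrite eqxx orbT.
case: i i' => j b [j' b'] /B Bj /B Bj'; rewrite /basis /=.
case: b; case: b' => ne /=.
- have jj' : j != j' by apply: contra ne => /eqP ->.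
  by rewrite (ip_cos_cos ha dA pA); have [-> ->] := E _ _ Bj Bj' jj'; rewrite addr0 mulr0.
- exact: (ip_cos_sin ha dA pA).
- by rewrite ipC; exact: (ip_cos_sin ha dA pA).
- have jj' : j != j' by apply: contra ne => /eqP ->.
  by rewrite (ip_sin_sin ha dA pA); have [-> ->] := E _ _ Bj Bj' jj'; rewrite subr0 mulr0.
Qed.

Notation proj := (orth_proj leb2 cell basis).

(** This says that q is in the span of finitely many basis functions, in the form that [best_approx]
    consumes. Allowing every larger [S] makes the statement stable under sums of two such q. *)
Lemma trig_in_span q : trig A q -> exists2 S0, all basis_index S0 &
  forall S, uniq S -> all basis_index S -> {subset S0 <= S} ->
  forall u, sqint u -> ip (fun z => u z - proj S u z) q = 0.
Proof.
have base i : basis_index i -> exists2 S0, all basis_index S0 &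
  forall S, uniq S -> all basis_index S -> {subset S0 <= S} ->
  forall u, sqint u -> ip (fun z => u z - proj S u z) (basis i) = 0.
  move=> Bi; exists [:: i]; first by rewrite /= Bi.
  move=> S uS /allP BS sS u su; apply: ip_sub_orth_proj => //.
  - exact: basis_sqint.
  - by move=> k k' /BS Bk /BS Bk'; exact: ip_basis_orth.
  - by move=> k /BS; exact: ip_basis_gt0.
  - by apply: sS; rewrite inE.
have sq S u : sqint u -> sqint (fun z => u z - proj S u z).
  by move=> su; apply: sqintB => //; apply: sqint_orth_proj => // k; exact: basis_sqint.
elim=> [j|j|p q1 tp [S1 B1 IH1] tq [S2 B2 IH2]|c p tp [S1 B1 IH1]].
- case/or3P: (freq_posP j) => [pj|/eqP ->|pj].
  + by apply: (base (j, true)); rewrite /basis_index pj.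
  + by apply: (base (0, true)); rewrite /basis_index eqxx orbT.
  + rewrite (_ : (fun z => cos _) = basis (- j, true)); last first.
      by apply/funext => z; rewrite /basis /= thetaN cosN.
    by apply: base; rewrite /basis_index pj.
- case/or3P: (freq_posP j) => [pj|/eqP ->|pj].
  + by apply: (base (j, false)); rewrite /basis_index pj.
  + exists [::] => // S _ _ _ u su; rewrite ipC (_ : (fun z => sin _) = fun=> 0) ?ip0l//.
    by apply/funext => z; rewrite theta0 sin0.
  + have [|S0 B0 H] := base (- j, false); first by rewrite /basis_index pj.
    exists S0 => // S uS BS sS u su;
      rewrite ipC (_ : (fun z => sin _) = fun z => -1 * basis (- j, false) z).
      by rewrite ipZl ?[ip (basis _) _]ipC ?H ?mulr0//; [exact: basis_sqint|exact: sq].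
    by apply/funext => z; rewrite /basis /= thetaN sinN mulN1r opprK.
- exists (S1 ++ S2); first by rewrite all_cat B1.
  move=> S uS BS sS u su; rewrite ipC ipDl.
  + rewrite ipC IH1//; last by move=> k k1; apply: sS; rewrite mem_cat k1.
    by rewrite ipC IH2 ?addr0// => k k2; apply: sS; rewrite mem_cat k2 orbT.
  + exact: mC.
  + exact: (tw_sqint ha dA (trig_tw a tp)).
  + exact: (tw_sqint ha dA (trig_tw a tq)).
  + exact: sq.
- exists S1 => // S uS BS sS u su; rewrite ipC ipZl.
  + by rewrite ipC IH1 ?mulr0.
  + exact: mC.
  + exact: (tw_sqint ha dA (trig_tw a tp)).
  + exact: sq.
Qed.

(* [v = L u] for a skew-adjoint [L] with [L cos = - lam sin], [L sin = lam cos], tested weakly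
   against the basis. *)
Definition multiplier (u v : R * R -> R) (lam : int * int -> R) :=
  forall j, ip v (fun z => cos (theta j z)) = lam j * ip u (fun z => sin (theta j z)) /\
            ip v (fun z => sin (theta j z)) = - lam j * ip u (fun z => cos (theta j z)).

(** A skew-adjoint multiplier exchanges the cosine and the sine of a frequency. *)
Definition swap_index (i : (int * int) * bool) := (i.1, ~~ i.2).

Lemma swap_indexK : involutive swap_index.
Proof. by case=> j b; rewrite /swap_index /= negbK. Qed.

(** Bessel for v on the swapped indices: its coefficients are those of u times lam up to sign, and
    both waves of a positive frequency have the same norm. Frequency 0 is excluded because its
    swapped wave vanishes. *)
Lemma multiplier_energy u v lam S : sqint v -> multiplier u v lam -> uniq S ->
  all (fun i => freq_pos i.1) S ->
  \sum_(i <- S) lam i.1 ^+ 2 * (ip u (basis i) ^+ 2 / ip (basis i) (basis i)) <= ip v v.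
Proof.
move=> sv uv uS /allP pS.
have uS' : uniq (map swap_index S) by rewrite map_inj_uniq//; exact: inv_inj swap_indexK.
have BS' i : i \in map swap_index S -> basis_index i.
  by move=> /mapP[k kS ->]; rewrite /basis_index /= pS.
apply: le_trans (@bessel _ _ _ leb2 _ mC _ basis (map swap_index S) _ uS' _ _ v sv); last first.
- by move=> i /BS'; exact: ip_basis_gt0.
- by move=> i k /BS' Bi /BS' Bk; exact: ip_basis_orth.
- exact: basis_sqint.
rewrite /energy big_map big_seq [leRHS]big_seq ler_sum// => -[j b] jS.
have /= pj := pS _ jS; rewrite /swap_index /= !ip_basis_pos//= mulrA ler_wpM2r//.
  by rewrite invr_ge0 mulr_ge0// ltW// M2_gt0.
case: b pj jS => pj _; rewrite /basis /=; have [h1 h2] := uv j.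
  by rewrite h2 exprMn sqrrN.
by rewrite h1 exprMn.
Qed.

(** Up to e, the norm of u is a finite energy by density and [best_approx]. The pointwise bound on
    the weights is multiplied by each energy term and summed, and [multiplier_energy] is applied to
    v, w and y. *)
Lemma spectral_estimate (u v w y : R * R -> R) (lam : int * int -> R) (P Q : R) :
  sqint u -> sqint v -> sqint w -> sqint y -> 0 <= P -> 0 <= Q ->
  \int[leb2]_(z in cell) u z = 0 ->
  multiplier u v lam -> multiplier u w (fun j => j.1%:~R) -> multiplier u y (fun j => j.2%:~R) ->
  (forall j : int * int, j != 0 -> 1 <= lam j ^+ 2 * P + (j.1%:~R ^+ 2 + j.2%:~R ^+ 2) * Q) ->
  ip u u <= P * ip v v + Q * (ip w w + ip y y).
Proof.
move=> su sv sw sy P0 Q0 u0 uv uw uy lamP.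
apply/ler_addgt0Pr => e e0.
have [_ /(_ _ e0) [q tq qe]] := trig_dense ha dA su.
have [S0 /allP B0 H0] := trig_in_span tq.
pose S := undup S0.
have uS : uniq S by exact: undup_uniq.
have BS : all basis_index S by apply/allP => i; rewrite mem_undup; exact: B0.
have sS : {subset S0 <= S} by move=> i; rewrite mem_undup.
have u_q := H0 S uS BS sS u su.
have BS' := allP BS.
apply: le_trans (@best_approx _ _ _ leb2 _ mC _ basis S _ uS _ _ u q su _ u_q) _.
- exact: basis_sqint.
- by move=> i k /BS' Bi /BS' Bk; exact: ip_basis_orth.
- by move=> i /BS'; exact: ip_basis_gt0.
- exact: (tw_sqint ha dA (trig_tw a tq)).
apply: lerD; last exact: qe.
pose S' := [seq i <- S | freq_pos i.1].
have uS' : uniq S' by exact: filter_uniq.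
have pS' : all (fun i => freq_pos i.1) S' by exact: filter_all.
(* The constant mode contributes nothing because u has mean zero. *)
have -> : energy leb2 cell basis S u = energy leb2 cell basis S' u.
  rewrite /energy /S' big_filter big_seq [RHS]big_mkcond [RHS]big_seq.
  apply: eq_bigr => i /BS' /orP[->//|/eqP ->].
  rewrite [freq_pos _](_ : _ = false)//=.
  have -> : ip u (basis (0, true)) = 0; last by rewrite expr0n mul0r.
  by rewrite -[RHS]u0; apply: eq_Rintegral => z _; rewrite /basis /= theta0 cos0 mulr1.
have := ler_wpM2l P0 (multiplier_energy sv uv uS' pS').
have := ler_wpM2l Q0 (multiplier_energy sw uw uS' pS').
have := ler_wpM2l Q0 (multiplier_energy sy uy uS' pS').
rewrite !mulr_sumr mulrDr => h1 h2 h3; apply: le_trans (lerD h3 (lerD h2 h1)).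
rewrite -!big_split /= /energy big_seq [leRHS]big_seq ler_sum// => i iS.
set E := _ / _; have E0 : 0 <= E.
  rewrite mulr_ge0 ?sqr_ge0// invr_ge0 ltW// ip_basis_gt0// /basis_index.
  by rewrite (allP pS' i iS).
have := ler_wpM2r E0 (lamP _ (freq_pos_neq0 (allP pS' i iS))); rewrite mul1r.
by move=> h; apply: le_trans h _; rewrite le_eqVlt; apply/orP; left; apply/eqP; ring.
Qed.

End SpectralEstimate.

Local Open Scope complex_scope.

(** * From weak derivatives to the estimate with free weights *)

Section SobolevEstimate.
Context {R : realType}.
Notation M := (pi *+ 2 : R).
Notation RR := (measurableTypeR R * measurableTypeR R)%type.
Notation leb2 := (@lebesgue2 R).
Notation cell := (@torus_cell R).
Notation sqint := (@sqint _ RR R leb2 cell).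
Notation ip := (@ip _ RR R leb2 cell).
Let mC := @measurable_cell R.

Lemma sqintM_continuous (v u : R * R -> R) : continuous v -> sqint u ->
  sqint (fun z => v z * u z).
Proof.
move=> cv su; have [K vK] := continuous_cell_bounded cv.
rewrite (_ : (fun z => v z * u z) = fun z => u z * v z).
  exact: sqintM_bdd su (continuous2_measurable cv) vK.
by apply/funext => z; rewrite mulrC.
Qed.

Lemma normc_sqr (x : R[i]) : Normc.normc x ^+ 2 = complex.Re x ^+ 2 + complex.Im x ^+ 2.
Proof. by case: x => x y /=; rewrite sqr_sqrtr// addr_ge0 ?sqr_ge0. Qed.

Lemma sqint_Re (f : R * R -> R[i]) : torus_L2 f -> sqint (fun z => complex.Re (f z)).
Proof.
move=> [_ mr mi fi]; split=> //; apply: le_integrable fi => //.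
  by apply/measurable_EFinP/(measurable_funS measurableT) => //; exact: measurable_funX.
move=> z _ /=; rewrite lee_fin normc_sqr !ger0_norm ?addr_ge0 ?sqr_ge0//.
by rewrite lerDl sqr_ge0.
Qed.

Lemma sqint_Im (f : R * R -> R[i]) : torus_L2 f -> sqint (fun z => complex.Im (f z)).
Proof.
move=> [_ mr mi fi]; split=> //; apply: le_integrable fi => //.
  by apply/measurable_EFinP/(measurable_funS measurableT) => //; exact: measurable_funX.
move=> z _ /=; rewrite lee_fin normc_sqr !ger0_norm ?addr_ge0 ?sqr_ge0//.
by rewrite lerDr sqr_ge0.
Qed.

Lemma L2norm_sqr (f : R * R -> R[i]) :
  sqint (fun z => complex.Re (f z)) -> sqint (fun z => complex.Im (f z)) ->
  L2norm f ^+ 2 = ip (fun z => complex.Re (f z)) (fun z => complex.Re (f z)) +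
                  ip (fun z => complex.Im (f z)) (fun z => complex.Im (f z)).
Proof.
move=> sr si; rewrite /L2norm sqr_sqrtr; last first.
  by apply: Rintegral_ge0 => z _; exact: sqr_ge0.
rewrite /ip -(RintegralD mC (sqint_mul mC sr sr) (sqint_mul mC si si)).
by apply: eq_Rintegral => z _; rewrite normc_sqr !expr2.
Qed.

Variables (a A : R -> R) (alpha : R).
Hypothesis ha : smooth_circle a.
Hypothesis dA : forall t, derivable A t 1 /\ derive1 A t = a t - alpha.
Hypothesis pA : periodic A M.

Lemma continuous_coef (b : R) : continuous (fun z : R * R => a z.1 - b).
Proof. exact: (tw_continuous ha dA (tw_add (tw_a a A) (tw_cst a A (- b)))). Qed.

Section Weak.
Variables (u ut ux : R * R -> R).
Hypothesis (su : sqint u) (sut : sqint ut) (sux : sqint ux).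
Hypothesis ut_weak : forall phi, smooth_torus phi -> ip u (partial_t phi) = - ip ut phi.
Hypothesis ux_weak : forall phi, smooth_torus phi -> ip u (partial_x phi) = - ip ux phi.

(** The choice b = 0 gives Y, and b = alpha gives the field with eigenvalues i l. *)
Let field b z := ut z + (a z.1 - b) * ux z.

Lemma sqint_field b : sqint (field b).
Proof.
by apply: sqintD => //; apply: sqintM_continuous => //; exact: continuous_coef.
Qed.

(** The coefficient a - b depends on t only, so it commutes with the x-derivative, and (a - b) p is
    again an admissible test function. *)
Lemma ip_field b p : tw a A p ->
  ip (field b) p = - ip u (fun z => partial_t p z + (a z.1 - b) * partial_x p z).
Proof.
move=> tp; have [tpt tpx] := tw_partial ha dA tp.
have tab : tw a A (fun z => a z.1 - b).
  by apply: tw_add; [exact: tw_a|exact: tw_cst].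
have tq : tw a A (fun z => (a z.1 - b) * p z) by exact: tw_mul.
have sqt := @tw_sqint R a A alpha ha dA.
rewrite (ipDl mC sut (sqintM_continuous (@continuous_coef b) sux) (sqt _ tp)).
have -> : ip (fun z => (a z.1 - b) * ux z) p = ip ux (fun z => (a z.1 - b) * p z).
  by apply: eq_Rintegral => z _; ring.
rewrite -[ip ut p]opprK -ut_weak; last exact: (tw_smooth ha dA pA tp).
rewrite -[ip ux _]opprK -ux_weak; last exact: (tw_smooth ha dA pA tq).
rewrite -opprD; congr (- _); rewrite ![ip u _]ipC.
rewrite (ipDl mC (sqt _ tpt) (sqt _ (tw_mul tab tpx)) su); congr (_ + ip _ _).
rewrite {1}/partial_x partialM;
  [|exact: (tw_differentiable ha dA tab)|exact: (tw_differentiable ha dA tp)].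
apply/funext => z; rewrite -/(partial_x _ _) (_ : 'D_(0, 1) _ z = 0) ?mulr0 ?addr0//.
by have := congr1 (fun h => h z) (partial_x_fst (fun t => a t - b)).
Qed.

(** The phase has t-derivative l - k (a - alpha); adding (a - b) k leaves a constant. *)
Lemma multiplier_field b :
  multiplier A u (field b) (fun j => j.1%:~R + j.2%:~R * (alpha - b)).
Proof.
have sqt := @tw_sqint R a A alpha ha dA.
move=> j; split.
- rewrite (ip_field b (tw_cos a A j)) (partial_t_cos dA) (partial_x_cos A) -mulN1r.
  rewrite ![ip u _]ipC -!ipZl//; try exact: mC; try exact: (sqt _ (tw_sin a A j)).
    by apply: eq_Rintegral => z _; ring.
  rewrite (_ : (fun z => _) = (fun z => - (j.1%:~R + j.2%:~R * (alpha - b)) * sin (theta A j z))).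
    exact: (sqintZ mC _ (sqt _ (tw_sin a A j))).
  by apply/funext => z; ring.
- rewrite (ip_field b (tw_sin a A j)) (partial_t_sin dA) (partial_x_sin A) -mulN1r.
  rewrite ![ip u _]ipC -!ipZl//; try exact: mC; try exact: (sqt _ (tw_cos a A j)).
    by apply: eq_Rintegral => z _; ring.
  rewrite (_ : (fun z => _) = (fun z => (j.1%:~R + j.2%:~R * (alpha - b)) * cos (theta A j z))).
    exact: (sqintZ mC _ (sqt _ (tw_cos a A j))).
  by apply/funext => z; ring.
Qed.

Lemma multiplier_x : multiplier A u ux (fun j => j.2%:~R).
Proof.
have sqt := @tw_sqint R a A alpha ha dA.
move=> j; split.
- rewrite -[LHS]opprK -ux_weak; last exact: (tw_smooth ha dA pA (tw_cos a A j)).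
  rewrite (partial_x_cos A) ![ip u _]ipC -mulN1r -!ipZl//; try exact: mC;
    try exact: (sqt _ (tw_sin a A j)).
    by apply: eq_Rintegral => z _; ring.
  exact: (sqt _ (tw_mul (tw_N (tw_sin a A j)) (tw_cst a A _))).
- rewrite -[LHS]opprK -ux_weak; last exact: (tw_smooth ha dA pA (tw_sin a A j)).
  rewrite (partial_x_sin A) ![ip u _]ipC -mulN1r -!ipZl//; try exact: mC;
    try exact: (sqt _ (tw_cos a A j)).
    by apply: eq_Rintegral => z _; ring.
  exact: (sqt _ (tw_mul (tw_cos a A j) (tw_cst a A _))).
Qed.

Lemma field_bound b K : (forall z, cell z -> `|a z.1 - b| <= K) ->
  ip (field b) (field b) <= 2 * ip ut ut + 2 * K ^+ 2 * ip ux ux.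
Proof.
move=> bK; have sbux := sqintM_continuous (@continuous_coef b) sux.
apply: le_trans (ip_sqrD_le mC sut sbux) _; rewrite lerD2l -mulrA ler_wpM2l//.
rewrite (_ : (fun z => (a z.1 - b) * ux z) = fun z => ux z * (a z.1 - b)).
  exact: (ipM_bdd_le mC sux (continuous2_measurable (@continuous_coef b)) bK).
by apply/funext => z; rewrite mulrC.
Qed.

End Weak.

(** The term [- 0] presents the integrands as the field with b = 0. *)
Lemma directional_sqr (ft fx : R * R -> R[i]) : torus_L2 ft -> torus_L2 fx ->
  L2norm (directional a ft fx) ^+ 2 =
    ip (fun z => complex.Re (ft z) + (a z.1 - 0) * complex.Re (fx z))
       (fun z => complex.Re (ft z) + (a z.1 - 0) * complex.Re (fx z)) +
    ip (fun z => complex.Im (ft z) + (a z.1 - 0) * complex.Im (fx z))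
       (fun z => complex.Im (ft z) + (a z.1 - 0) * complex.Im (fx z)).
Proof.
move=> Lt Lx.
have sr := sqint_field (sqint_Re Lt) (sqint_Re Lx) 0.
have si := sqint_field (sqint_Im Lt) (sqint_Im Lx) 0.
have Er : (fun z => complex.Re (directional a ft fx z)) =
    fun z => complex.Re (ft z) + (a z.1 - 0) * complex.Re (fx z).
  by apply/funext => z; rewrite /directional; case: (ft z) (fx z) => p q [r s] /=; ring.
have Ei : (fun z => complex.Im (directional a ft fx z)) =
    fun z => complex.Im (ft z) + (a z.1 - 0) * complex.Im (fx z).
  by apply/funext => z; rewrite /directional; case: (ft z) (fx z) => p q [r s] /=; ring.
have sr' : sqint (fun z => complex.Re (directional a ft fx z)) by rewrite Er.
have si' : sqint (fun z => complex.Im (directional a ft fx z)) by rewrite Ei.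
by rewrite (L2norm_sqr sr' si') Er Ei.
Qed.

Lemma L2norm2_sqr (g h : R * R -> R[i]) : L2norm2 g h ^+ 2 = L2norm g ^+ 2 + L2norm h ^+ 2.
Proof. by rewrite /L2norm2 sqr_sqrtr// addr_ge0 ?sqr_ge0. Qed.

Lemma ReM_real (x : R[i]) (y : R) : complex.Re (x * y%:C) = complex.Re x * y.
Proof. by case: x => p q /=; ring. Qed.

Lemma ImM_real (x : R[i]) (y : R) : complex.Im (x * y%:C) = complex.Im x * y.
Proof. by case: x => p q /=; ring. Qed.

Lemma weak_Re (f g : R * R -> R[i]) (p q : R * R -> R) :
  torus_Cintegral (fun z => f z * (p z)%:C) = - torus_Cintegral (fun z => g z * (q z)%:C) ->
  ip (fun z => complex.Re (f z)) p = - ip (fun z => complex.Re (g z)) q.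
Proof.
move=> /(congr1 (@complex.Re R)); rewrite /torus_Cintegral /= /ip => H.
transitivity (\int[leb2]_(z in cell) complex.Re (f z * (p z)%:C)).
  by apply: eq_Rintegral => z _; rewrite ReM_real.
by rewrite H; congr (- _); apply: eq_Rintegral => z _; rewrite ReM_real.
Qed.

Lemma weak_Im (f g : R * R -> R[i]) (p q : R * R -> R) :
  torus_Cintegral (fun z => f z * (p z)%:C) = - torus_Cintegral (fun z => g z * (q z)%:C) ->
  ip (fun z => complex.Im (f z)) p = - ip (fun z => complex.Im (g z)) q.
Proof.
move=> /(congr1 (@complex.Im R)); rewrite /torus_Cintegral /= /ip => H.
transitivity (\int[leb2]_(z in cell) complex.Im (f z * (p z)%:C)).
  by apply: eq_Rintegral => z _; rewrite ImM_real.
by rewrite H; congr (- _); apply: eq_Rintegral => z _; rewrite ImM_real.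
Qed.

(** X and Y stand for the field energies of the real and imaginary parts. The constant contains both
    k and k', so that one constant serves Y and the straightened field. *)
Lemma gradient_arith (X Y T T' G G' k k' : R) : 0 <= T -> 0 <= T' -> 0 <= G -> 0 <= G' ->
  0 <= k -> 0 <= k' -> X <= 2 * T + 2 * k * G -> Y <= 2 * T' + 2 * k * G' ->
  (X + G) + (Y + G') <= (3 + 2 * k + 2 * k') * ((T + T') + (G + G')).
Proof.
move=> T0 T0' G0 G0' k0 k0' hX hY.
have := mulr_ge0 k0 (addr_ge0 T0 T0'); have := mulr_ge0 k0' (addr_ge0 T0 T0').
have := mulr_ge0 k0' (addr_ge0 G0 G0'); nra.
Qed.

(** P and Q stay free so that the cut-off may depend on f. The first bound settles later the case of
    a vanishing gradient. *)
Lemma H1_estimate : exists2 C : R, 0 < C &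
  forall f ft fx, H1_gradient f ft fx ->
    L2norm (directional a ft fx) ^+ 2 <= C * L2norm2 ft fx ^+ 2 /\
    (torus_Cintegral f = 0 -> forall P Q : R, 0 <= P -> 0 <= Q ->
      (forall j : int * int, j != 0 ->
        1 <= (j.1%:~R + j.2%:~R * alpha) ^+ 2 * P + (j.1%:~R ^+ 2 + j.2%:~R ^+ 2) * Q) ->
      L2norm f ^+ 2 <= P * L2norm (directional a ft fx) ^+ 2 + Q * (C * L2norm2 ft fx ^+ 2)).
Proof.
have [K0 aK0] := continuous_cell_bounded (@continuous_coef 0).
have [K1 aK1] := continuous_cell_bounded (@continuous_coef alpha).
exists (3 + 2 * K0 ^+ 2 + 2 * K1 ^+ 2).
  by have := sqr_ge0 K0; have := sqr_ge0 K1; lra.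
move=> f ft fx [Lf Lt Lx wt wx].
have [sr si] := (sqint_Re Lf, sqint_Im Lf).
have [str sti] := (sqint_Re Lt, sqint_Im Lt).
have [sxr sxi] := (sqint_Re Lx, sqint_Im Lx).
rewrite directional_sqr// L2norm2_sqr !L2norm_sqr//.
have B0r := field_bound str sxr aK0; have B0i := field_bound sti sxi aK0.
have B1r := field_bound str sxr aK1; have B1i := field_bound sti sxi aK1.
have gtr := ip_ge0 leb2 cell (fun z => complex.Re (ft z)).
have gti := ip_ge0 leb2 cell (fun z => complex.Im (ft z)).
have gxr := ip_ge0 leb2 cell (fun z => complex.Re (fx z)).
have gxi := ip_ge0 leb2 cell (fun z => complex.Im (fx z)).
have k0 := sqr_ge0 K0; have k1 := sqr_ge0 K1.
split.
  apply: le_trans (gradient_arith gtr gti gxr gxi k0 k1 B0r B0i).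
  by rewrite addrACA lerDl addr_ge0.
move=> f0 P Q P0 Q0 PQ.
have E := congr1 (@complex.Re R) f0; have E' := congr1 (@complex.Im R) f0.
have est (u ut ux : R * R -> R) : sqint u -> sqint ut -> sqint ux ->
    (forall phi, smooth_torus phi -> ip u (partial_t phi) = - ip ut phi) ->
    (forall phi, smooth_torus phi -> ip u (partial_x phi) = - ip ux phi) ->
    \int[leb2]_(z in cell) u z = 0 ->
    ip u u <= P * ip (fun z => ut z + (a z.1 - 0) * ux z) (fun z => ut z + (a z.1 - 0) * ux z) +
      Q * (ip (fun z => ut z + (a z.1 - alpha) * ux z) (fun z => ut z + (a z.1 - alpha) * ux z)
        + ip ux ux).
  move=> su sut sux hut hux u0.
  apply: (spectral_estimate ha dA pA su (sqint_field sut sux 0) (sqint_field sut sux alpha) sux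
    P0 Q0 u0
    (multiplier_field su sut sux hut hux 0)) => //.
  - move=> j; have := multiplier_field su sut sux hut hux alpha j.
    by rewrite subrr mulr0 addr0.
  - exact: multiplier_x.
  - by move=> j j0; rewrite subr0; exact: PQ.
have er := est _ _ _ sr str sxr (fun phi sp => weak_Re (wt phi sp)) (fun phi sp => weak_Re (wx
  phi sp)) E.
have ei := est _ _ _ si sti sxi (fun phi sp => weak_Im (wt phi sp)) (fun phi sp => weak_Im (wx
  phi sp)) E'.
apply: le_trans (lerD er ei) _.
rewrite addrACA -!mulrDr lerD2l ler_wpM2l//.
apply: le_trans (gradient_arith gtr gti gxr gxi k1 k0 B1r B1i) _.
by rewrite -!addrA [2 * _ + 2 * _]addrC.
Qed.

End SobolevEstimate.

(** * Diophantine approximation: Dirichlet, Liouville and irrationality exponents *)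

Section Diophantine.
Context {R : realType}.
Implicit Types (alpha delta mu : R).

Lemma irrational_neq alpha (l k : int) : irrational alpha -> k != 0 -> l%:~R + k%:~R * alpha != 0.
Proof.
move=> ia k0; apply/negP => /eqP H; apply: ia.
exists (- l%:~R / k%:~R) => //=; have k0R : k%:~R != 0 :> R by rewrite intr_eq0.
rewrite fmorph_div /= rmorphN /= !ratr_int; apply: (mulfI k0R).
by rewrite mulrCA mulfV// mulr1; apply/esym/eqP; rewrite -addr_eq0 addrC H.
Qed.

Lemma dist_int_gt0 (x : R) : (forall l : int, l%:~R + x != 0) ->
  exists2 d : R, 0 < d & forall l : int, d <= `|l%:~R + x|.
Proof.
move=> xl; pose m := Num.floor x; have /andP[m1 m2] := floor_itv x.
have mx : m%:~R < x.
  rewrite lt_neqAle m1 andbT; apply: contra (xl (- m)) => /eqP <-.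
  by rewrite mulrNz addNr.
exists (Num.min (x - m%:~R) ((m + 1)%:~R - x)).
  by rewrite lt_min !subr_gt0 mx.
move=> l; rewrite ge_min; have [lm|lm] := leP (- l) m.
  have h : (- m)%:~R <= l%:~R :> R by rewrite ler_int lerNl.
  by apply/orP; left; apply: le_trans (ler_norm _); rewrite mulrNz in h; lra.
have h : (m + 1)%:~R <= (- l)%:~R :> R by rewrite ler_int lezD1.
apply/orP; right; rewrite -normrN; apply: le_trans (ler_norm _).
by rewrite mulrNz in h; lra.
Qed.

(** Finitely many denominators are uniformly bounded away. This forces large denominators in
    [dirichlet] and treats small ones in [diophantine_of_exponent]. *)
Lemma dist_int_small alpha (N : nat) : irrational alpha ->
  exists2 d : R, 0 < d & forall l k : int, k != 0 -> (`|k| <= N)%N -> d <= `|l%:~R + k%:~R * alpha|.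
Proof.
move=> ia; elim: N => [|N [d d0 dP]].
  by exists 1 => // l k k0; rewrite leqn0 absz_eq0 (negbTE k0).
have [d1 d10 d1P] := @dist_int_gt0 (N.+1%:~R * alpha) (fun l => @irrational_neq alpha l N.+1 ia
  isT).
exists (Num.min d d1); first by rewrite lt_min d0.
move=> l k k0; rewrite leq_eqVlt => /predU1P[kN|kN]; last by rewrite ge_min dP.
rewrite ge_min; apply/orP; right.
case: (intP k) k0 kN => // n _ /= [nN].
  by have := d1P l; rewrite -nN.
have := d1P (- l); rewrite -normrN opprD -mulrNz opprK -nN.
by congr (_ <= `| _ |); congr (_ + _); rewrite -mulNr -mulrNz.
Qed.

Lemma dirichlet alpha (N : nat) : irrational alpha ->
  exists p q : int, (N < `|q|)%N /\ `|alpha - p%:~R / q%:~R| < (`|q|%N%:R ^+ 2)^-1.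
Proof.
move=> ia; have [d d0 dP] := dist_int_small N ia.
(* With Q > 1/d a denominator q up to N is impossible, as it would give d <= |q alpha - p| < 1/Q <
   d. *)
pose Q := (Num.truncn d^-1).+1.
have Qd : d^-1 < Q%:R by exact: truncnS_gt.
have Q0 : 0 < Q%:R :> R by [].
pose fr (i : nat) : R := i%:R * alpha - (Num.floor (i%:R * alpha))%:~R.
have fr0 i : 0 <= fr i by rewrite subr_ge0 floor_le.
have fr1 i : fr i < 1.
  by rewrite ltrBlDr addrC -[X in _ + X]/(1%:~R) -intrD floorD1_gt.
have bin_lt i : (Num.truncn (Q%:R * fr i) < Q)%N.
  by rewrite truncn_lt_nat ?mulr_ge0// -[ltRHS]mulr1 ltr_pM2l.
(* Pigeonhole: Q + 1 fractional parts in Q bins of width 1/Q. *)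
pose f (i : 'I_Q.+1) : 'I_Q := Ordinal (bin_lt i).
have : ~~ injectiveb f.
  apply/negP => /injectiveP /leq_card; rewrite !card_ord ltnn//.
move=> /injectivePn[i [j ij fij]].
wlog {ij} ltij : i j fij / (i < j)%N.
  move=> H; have [ltij|ltji|/ord_inj eij] := ltngtP i j; [exact: (H i j)|exact: (H j i)|].
  by rewrite eij eqxx in ij.
have fE : Num.truncn (Q%:R * fr i) = Num.truncn (Q%:R * fr j) by move/(congr1 val): fij.
have close : `|fr j - fr i| < Q%:R^-1.
  have /andP[i1 i2] := truncn_itv (mulr_ge0 (ltW Q0) (fr0 i)).
  have /andP[j1 j2] := truncn_itv (mulr_ge0 (ltW Q0) (fr0 j)).
  rewrite -(ltr_pM2l Q0) mulfV ?gt_eqF// -[X in X * `|_|](gtr0_norm Q0) -normrM mulrBr.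
  rewrite fE -natr1 in i1 i2; rewrite -natr1 in j1 j2.
  by rewrite ltr_norml; apply/andP; split; lra.
pose q : nat := (j - i)%N; have q0 : (0 < q)%N by rewrite subn_gt0.
pose p : int := Num.floor (j%:R * alpha) - Num.floor (i%:R * alpha).
have qp : fr j - fr i = (- p)%:~R + (Posz q)%:~R * alpha.
  rewrite /fr /p -[(Posz q)%:~R]/(q%:R) natrB ?(ltnW ltij)// mulrNz intrD mulrNz; ring.
have qQ : (q <= Q)%N by rewrite (leq_trans (leq_subr _ _))// -ltnS.
exists p, (Posz q); split.
  rewrite ltnNge; apply/negP => qN.
  have := dP (- p) (Posz q); rewrite -qp => /(_ _ qN) H.
  have := lt_le_trans (le_lt_trans (H (lt0r_neq0 (q0 : 0 < Posz q))) close) (lexx _).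
  by rewrite ltNge -[leRHS]invrK lef_pV2 ?posrE ?invr_gt0// ltW.
have q0R : 0 < q%:R :> R by rewrite ltr0n.
have -> : alpha - p%:~R / (Posz q)%:~R = (fr j - fr i) / q%:R.
  by rewrite qp -[(Posz q)%:~R]/(q%:R) mulrNz; field; rewrite gt_eqF.
rewrite normrM normfV (gtr0_norm q0R) ltr_pdivrMr// (lt_le_trans close)//.
rewrite expr2 invfM -mulrA mulVf ?gt_eqF// mulr1 lef_pV2 ?posrE// ler_nat//.
Qed.

Lemma natr_ge1 (k : int) : k != 0 -> 1 <= `|k|%N%:R :> R.
Proof. by move=> k0; rewrite ler1n absz_gt0. Qed.

(** The strict inequality in [dirichlet] excludes mu = 2 too, so the requirement 2 <= delta holds
    for every exponent. *)
Lemma approximation_exponent_gt2 alpha mu : irrational alpha ->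
  approximation_exponent alpha mu -> 2 < mu.
Proof.
move=> ia [mu0 [N NP]]; have [p [q [Nq pq]]] := dirichlet N ia.
have := le_lt_trans (NP p q Nq) pq; rewrite ltNge => /negP H; rewrite ltNge; apply/negP => mu2.
apply: H; rewrite -powR_mulrn// -powRN ler_powR ?lerN2// natr_ge1// -absz_gt0.
exact: leq_ltn_trans Nq.
Qed.

Lemma approximation_exponent_ge alpha mu delta : mu <= delta ->
  approximation_exponent alpha mu -> approximation_exponent alpha delta.
Proof.
move=> md [mu0 [N NP]]; split; first exact: lt_le_trans md.
exists N => p q Nq; apply: le_trans (NP p q Nq).
by rewrite ler_powR ?lerN2// natr_ge1// -absz_gt0; exact: leq_ltn_trans Nq.
Qed.

(** A lower bound on the eigenvalues l + k alpha: the factor |k| turns the exponent -delta for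
    |alpha - p/q| into 1 - delta, and c accounts for small denominators. *)
Definition diophantine alpha delta := exists2 c : R, 0 < c &
  forall l k : int, k != 0 -> c * `|k|%N%:R `^ (1 - delta) <= `|l%:~R + k%:~R * alpha|.

Lemma normr_intr_absz (k : int) : `|k%:~R| = `|k|%N%:R :> R.
Proof. by rewrite natr_absz intr_norm. Qed.

Lemma powR_absz_le1 (k : int) delta : 1 <= delta -> k != 0 -> `|k|%N%:R `^ (1 - delta) <= 1 :> R.
Proof.
move=> d1 k0; rewrite -[leRHS](powRr0 (`|k|%N%:R)) ler_powR ?natr_ge1//; lra.
Qed.

Lemma diophantine_of_exponent alpha mu : irrational alpha ->
  approximation_exponent alpha mu -> diophantine alpha mu.
Proof.
move=> ia amu; have mu2 := approximation_exponent_gt2 ia amu.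
have [mu0 [N NP]] := amu; have [d d0 dP] := dist_int_small N ia.
(* The bound d serves |k| <= N, the bound 1 larger |k|. *)
exists (Num.min d 1); first by rewrite lt_min d0 ltr01.
move=> l k k0; have k1 := natr_ge1 k0; have kp : 0 < `|k|%N%:R :> R by exact: lt_le_trans k1.
have [kN|kN] := leqP `|k| N.
  apply: le_trans (dP l k k0 kN); apply: (@le_trans _ _ (Num.min d 1)); last by rewrite ge_min lexx.
  apply: ler_piMr; first by rewrite le_min ler01 ltW.
  by apply: powR_absz_le1 => //; lra.
have k0R : k%:~R != 0 :> R by rewrite intr_eq0.
have -> : `|l%:~R + k%:~R * alpha| = `|k|%N%:R * `|alpha - (- l)%:~R / k%:~R|.
  by rewrite -normr_intr_absz -normrM mulrNz; congr `|_|; field.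
apply: (@le_trans _ _ (`|k|%N%:R * `|k|%N%:R `^ (- mu))).
  rewrite (_ : `|k|%N%:R * _ = `|k|%N%:R `^ (1 - mu)).
    by apply: ler_piMl; rewrite ?powR_ge0// ge_min lexx orbT.
  by rewrite powRD ?powRr1 ?ltW//; apply/implyP => _; rewrite gt_eqF.
by apply: ler_wpM2l; [exact: ltW|exact: NP].
Qed.

Lemma quadratic_integer_equation alpha : algebraic_of_degree alpha 2 ->
  exists A B C : int, A != 0 /\ A%:~R * alpha ^+ 2 + B%:~R * alpha + C%:~R = 0.
Proof.
move=> [p [_ sp rp]].
have p2 : p`_2 != 0.
  by have := lead_coef_eq0 p; rewrite lead_coefE sp /= => ->; rewrite -size_poly_eq0 sp.
move: rp; rewrite rootE horner_coef size_map_poly sp !big_ord_recr big_ord0 /= add0r.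
rewrite !coef_map /= expr0 mulr1 expr1 => /eqP H.
pose n i : R := (numq p`_i)%:~R; pose d i : R := (denq p`_i)%:~R.
have d0 i : d i != 0 by rewrite intr_eq0 denq_neq0.
have rE i : ratr p`_i = n i / d i by [].
exists (numq p`_2 * denq p`_1 * denq p`_0), (numq p`_1 * denq p`_2 * denq p`_0),
  (numq p`_0 * denq p`_2 * denq p`_1); split.
  by rewrite !mulf_neq0 ?denq_neq0// numq_eq0.
rewrite !intrM -/(n 0%N) -/(n 1%N) -/(n 2%N) -/(d 0%N) -/(d 1%N) -/(d 2%N).
rewrite !rE in H; transitivity (d 0%N * d 1%N * d 2%N * 0); last by rewrite mulr0.
by rewrite -H; field; rewrite !d0.
Qed.

(* The conjugate root is irrational too, so the norm form A (l + k alpha) (l + k beta)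
   takes nonzero integer values. *)
Lemma diophantine_quadratic alpha : irrational alpha ->
  algebraic_of_degree alpha 2 -> diophantine alpha 2.
Proof.
move=> ia /quadratic_integer_equation[A [B [C [A0 E]]]].
have A0R : A%:~R != 0 :> R by rewrite intr_eq0.
pose beta := - B%:~R / A%:~R - alpha.
have CE : C%:~R = - (A%:~R * alpha ^+ 2) - B%:~R * alpha :> R by move: E; lra.
(* If |l + k alpha| < 1, the conjugate factor is at most |k| (1 + |beta - alpha|). The last 1 makes
   K at least 1 for the remaining case. *)
pose K : R := `|A%:~R| * (1 + `|beta - alpha|) + 1.
have Ap : 0 < `|A%:~R| :> R by rewrite normr_gt0.
have K0 : 0 < K by rewrite ltr_pwDr// mulr_ge0// addr_ge0.
exists K^-1; first by rewrite invr_gt0.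
move=> l k k0; have k1 := natr_ge1 k0; have kp : 0 < `|k|%N%:R :> R by exact: lt_le_trans k1.
have -> : 1 - 2 = -1 :> R by lra.
rewrite (powR_inv1 (ltW kp)) -invfM -[leLHS]mul1r ler_pdivrMr ?mulr_gt0//.
have F0 : (A * l ^+ 2 - B * l * k + C * k ^+ 2)%:~R =
    A%:~R * (l%:~R + k%:~R * alpha) * (l%:~R + k%:~R * beta) :> R.
  by rewrite !(intrD, intrM, mulrNz, rmorphXn) /= CE /beta; field.
have kR0 : k%:~R != 0 :> R by rewrite intr_eq0.
have bn0 : l%:~R + k%:~R * beta != 0.
  have -> : l%:~R + k%:~R * beta = - A%:~R^-1 * ((B * k - A * l)%:~R + (A * k)%:~R * alpha).
    by rewrite /beta !(intrD, intrM, mulrNz) /=; field.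
  by rewrite mulf_neq0 ?oppr_eq0 ?invr_eq0// irrational_neq// mulf_neq0.
have F1 : 1 <= `|A%:~R * (l%:~R + k%:~R * alpha) * (l%:~R + k%:~R * beta)|.
  rewrite -F0 normr_intr_absz natr_ge1// -(intr_eq0 R) F0.
  by rewrite !mulf_neq0// irrational_neq.
rewrite !normrM in F1.
have [x1|x1] := leP 1 `|l%:~R + k%:~R * alpha|.
  rewrite (le_trans x1)// ler_peMr//.
  have : 1 <= K by rewrite lerDr mulr_ge0// addr_ge0.
  by move=> K1; rewrite -[leLHS]mulr1 ler_pM.
have bk : `|l%:~R + k%:~R * beta| <= `|k|%N%:R * (1 + `|beta - alpha|).
  have -> : l%:~R + k%:~R * beta = (l%:~R + k%:~R * alpha) + k%:~R * (beta - alpha) by ring.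
  by rewrite (le_trans (ler_normD _ _))// normrM normr_intr_absz mulrDr mulr1 lerD// ltW//
    (lt_le_trans x1).
apply: le_trans F1 _; rewrite mulrAC mulrC ler_wpM2l//.
apply: (@le_trans _ _ (`|A%:~R| * (`|k|%N%:R * (1 + `|beta - alpha|)))); first by rewrite ler_wpM2l.
by rewrite mulrCA [leRHS]mulrC; apply: ler_wpM2l; [exact: ltW|rewrite /K lerDl].
Qed.

Lemma exponent_of_not_liouville alpha : irrational alpha -> ~ liouville alpha ->
  exists mu : R, approximation_exponent alpha mu.
Proof.
move=> ia nl; apply: contrapT => H; apply: nl; split => //.
rewrite /irrationality_measure (_ : approximation_exponent alpha = set0) ?image_set0 ?ereal_inf0//.
by apply/seteqP; split => // mu amu; apply: H; exists mu.
Qed.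

(** The infimum need not be attained: strictness provides an exponent below delta, and exponents are
    stable upwards. *)
Lemma exponent_of_measure_lt alpha delta :
  (irrationality_measure alpha < delta%:E)%E -> approximation_exponent alpha delta.
Proof.
move=> /ereal_inf_lt[_ [mu amu <-]]; rewrite lte_fin => md.
exact: approximation_exponent_ge (ltW md) amu.
Qed.

Lemma not_liouville_of_exponent alpha mu : approximation_exponent alpha mu -> ~ liouville alpha.
Proof.
move=> amu [_ H]; have : (irrationality_measure alpha <= mu%:E)%E.
  by apply: ereal_inf_lbound; exists mu.
by rewrite H leye_eq.
Qed.

End Diophantine.

(** * The directional inequality from a Diophantine bound *)

Section Poincare.
Context {R : realType}.
Variable a : R -> R.
Hypothesis ha : smooth_circle a.
Notation alpha := (circle_mean a).

Lemma smooth_circle_continuous : continuous a.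
Proof. by move=> t; apply/differentiable_continuous/derivable1_diffP; exact: (ha.2 0%N t). Qed.

(* Either the frequency is at least [k], or the Diophantine bound gives a divisor at least
   [c k^(1 - delta)]. *)
Lemma small_divisor_bound (x c delta k : R) (l m : int) : 1 <= delta -> 0 < c <= 1 -> 0 < k ->
  (l, m) != 0 -> (m != 0 -> c * `|m|%N%:R `^ (1 - delta) <= `|l%:~R + m%:~R * x|) ->
  1 <= (l%:~R + m%:~R * x) ^+ 2 * (k `^ (delta - 1) / c) ^+ 2 +
       (l%:~R ^+ 2 + m%:~R ^+ 2) * k^-1 ^+ 2.
Proof.
move=> d1 /andP[c0 c1] k0 lm dioph; have w0 : 0 < k `^ (delta - 1) by exact: powR_gt0.
have sq1 (y : R) : 1 <= `|y| -> 1 <= y ^+ 2.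
  by move=> y1; rewrite -real_normK ?num_real// exprn_ege1.
have L0 : 0 <= (l%:~R + m%:~R * x) ^+ 2 * (k `^ (delta - 1) / c) ^+ 2.
  by apply: mulr_ge0; exact: sqr_ge0.
have [kN|kN] := leP (k ^+ 2) (l%:~R ^+ 2 + m%:~R ^+ 2).
  apply: (@le_trans _ _ ((l%:~R ^+ 2 + m%:~R ^+ 2) * k^-1 ^+ 2)); last by rewrite lerDr.
  by rewrite exprVn ler_pdivlMr ?exprn_gt0// mul1r.
apply: (@le_trans _ _ ((l%:~R + m%:~R * x) ^+ 2 * (k `^ (delta - 1) / c) ^+ 2)); last first.
  by rewrite lerDl mulr_ge0 ?sqr_ge0// addr_ge0 ?sqr_ge0.
rewrite -exprMn; apply/sq1; rewrite normrM (gtr0_norm (divr_gt0 w0 c0)).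
(* For m = 0 the eigenvalue is the nonzero integer l; then k >= 1 because l^2 < k^2, and c <= 1 does
   the rest. *)
have [m0|m0] := eqVneq m 0.
  have l0 : l != 0 by apply: contra lm => /eqP ->; rewrite m0.
  have l1 := @natr_ge1 R l l0.
  rewrite m0 mul0r addr0 normr_intr_absz.
  have k1 : 1 <= k.
    rewrite -(@ler_pXn2r _ 2) ?nnegrE ?(ltW k0)// expr1n; apply: le_trans (ltW kN).
    by rewrite m0 expr0n addr0; apply/sq1; rewrite normr_intr_absz.
  rewrite -[leLHS]mulr1; apply: ler_pM => //.
  rewrite ler_pdivlMr// mul1r (le_trans c1)// -[leLHS](powRr0 k) ler_powR//; lra.
have m1 := @natr_ge1 R m m0; have mp : 0 < `|m|%N%:R :> R by exact: lt_le_trans m1.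
have mk : `|m|%N%:R <= k.
  rewrite -(@ler_pXn2r _ 2) ?nnegrE ?(ltW k0)// ltW// (le_lt_trans _ kN)//.
  by rewrite -normr_intr_absz real_normK ?num_real// lerDr sqr_ge0.
apply: (@le_trans _ _ (c * k `^ (1 - delta) * (k `^ (delta - 1) / c))).
  have -> : c * k `^ (1 - delta) * (k `^ (delta - 1) / c) = k `^ (1 - delta) * k `^ (delta - 1).
    by field; rewrite gt_eqF.
  rewrite -opprB powRN mulVf// gt_eqF//.
apply: ler_wpM2r; first by rewrite ltW// divr_gt0.
apply: le_trans (dioph m0); rewrite ler_pM2l// -opprB !powRN.
by rewrite lef_pV2 ?posrE ?powR_gt0// ge0_ler_powR ?nnegrE ?(ltW k0)//; lra.
Qed.

Lemma poincare_of_diophantine delta : 2 <= delta -> diophantine alpha delta ->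
  directional_poincare a delta.
Proof.
move=> d2 [c0 c00 dioph]; split => //.
have [A [dA pA]] := circle_primitive smooth_circle_continuous ha.1.
have [C C0 HC] := H1_estimate ha dA pA.
pose c := Num.min c0 1; have cP : 0 < c <= 1 by rewrite lt_min c00 ltr01 ge_min lexx orbT.
have /andP[cp c1] := cP.
have dioph' (l m : int) : m != 0 -> c * `|m|%N%:R `^ (1 - delta) <= `|l%:~R + m%:~R * alpha|.
  move=> m0; apply: le_trans (dioph l m m0); apply: ler_wpM2r; first exact: powR_ge0.
  by rewrite ge_min lexx.
pose D := Num.sqrt (2 * C); have D0 : 0 < D by rewrite sqrtr_gt0 mulr_gt0.
have DD : D ^+ 2 = 2 * C by rewrite sqr_sqrtr// ltW// mulr_gt0.
(* Read off from F <= 2 (D G / F)^(delta - 1) Y / c, obtained below. *)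
exists (c / (2 * D `^ (delta - 1))); first by rewrite divr_gt0 ?mulr_gt0 ?powR_gt0.
move=> f ft fx Hf f0; have [HY /(_ f0) HF] := HC f ft fx Hf.
move: HY HF.
have : 0 <= L2norm (directional a ft fx) by exact: sqrtr_ge0.
have : 0 <= L2norm2 ft fx by exact: sqrtr_ge0.
have : 0 <= L2norm f by exact: sqrtr_ge0.
move: (L2norm f) (L2norm2 ft fx) (L2norm (directional a ft fx)) => F G Y F0 G0 Y0 HY HF.
have main (k : R) : 0 < k ->
    F ^+ 2 <= (k `^ (delta - 1) / c) ^+ 2 * Y ^+ 2 + k^-1 ^+ 2 * (C * G ^+ 2).
  move=> k0; apply: HF; rewrite ?sqr_ge0// => -[l m] lm /=.
  by apply: small_divisor_bound => //; [lra|exact: dioph'].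
have [F00|Fn0] := eqVneq F 0.
  by rewrite F00 powR0 ?mulr0 ?mulr_ge0 ?powR_ge0// gt_eqF//; lra.
have Fp : 0 < F by rewrite lt_neqAle eq_sym Fn0.
(* The optimal cut-off would be 0 here. The cut-off 1 works instead, since the directional
   derivative vanishes with the gradient, contradicting F > 0. *)
have [G00|Gn0] := eqVneq G 0.
  have Y00 : Y ^+ 2 = 0 by apply/eqP; rewrite eq_le sqr_ge0 andbT; move: HY;
    rewrite G00 expr0n mulr0.
  have := main 1 ltr01; rewrite Y00 G00 expr0n !mulr0 addr0 => F2.
  by have := exprn_gt0 2 Fp; rewrite ltNge F2.
have Gp : 0 < G by rewrite lt_neqAle eq_sym Gn0.
(* With this cut-off the gradient term is half of [F ^+ 2]. *)
pose k := D * G / F; have k0 : 0 < k by rewrite divr_gt0 ?mulr_gt0.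
pose w := k `^ (delta - 1); have w0 : 0 < w by exact: powR_gt0.
have FY : F <= 2 * (w / c * Y).
  have h2 : k^-1 ^+ 2 * (C * G ^+ 2) = F ^+ 2 / 2.
    have -> : C = D ^+ 2 / 2 by rewrite DD; field.
    by rewrite /k; field; rewrite !gt_eqF.
  have := main k k0; rewrite h2 -/w -exprMn => h.
  have wY : 0 <= w / c * Y by rewrite mulr_ge0// ltW// divr_gt0.
  have h4 : F ^+ 2 <= (2 * (w / c * Y)) ^+ 2.
    rewrite [X in _ <= X]exprMn; have := sqr_ge0 (w / c * Y); move: h.
    by move: ((w / c * Y) ^+ 2) (F ^+ 2) => p q; rewrite (_ : 2 ^+ 2 = 4); [lra|ring].
  by rewrite -(@ler_pXn2r _ 2) ?nnegrE// mulr_ge0.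
have wE : w = D `^ (delta - 1) * G `^ (delta - 1) / F `^ (delta - 1).
  rewrite /w /k powRM ?mulr_ge0 ?invr_ge0 ?(ltW D0)// powRM ?(ltW D0)//; congr (_ * _).
  by rewrite -powR_inv1// -powRrM mulrC powRrM powR_inv1// powR_ge0.
have Fd : F `^ delta = F * F `^ (delta - 1) by rewrite mulr_powRB1//; lra.
have Dp := powR_gt0 (delta - 1) D0; have FP := powR_gt0 (delta - 1) Fp.
rewrite Fd mulrAC ler_pdivrMr ?mulr_gt0//.
apply: (@le_trans _ _ (c * (2 * (w / c * Y) * F `^ (delta - 1)))).
  by rewrite ler_pM2l// ler_pM2r.
by rewrite wE le_eqVlt; apply/orP; left; apply/eqP; field; rewrite !gt_eqF.
Qed.

End Poincare.

(** * Testing the inequality on single waves *)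

Section Converse.
Context {R : realType}.
Notation M := (pi *+ 2 : R).
Notation RR := (measurableTypeR R * measurableTypeR R)%type.
Notation leb2 := (@lebesgue2 R).
Notation cell := (@torus_cell R).
Notation sqint := (@sqint _ RR R leb2 cell).
Notation ip := (@ip _ RR R leb2 cell).
Let mC := @measurable_cell R.

Section TestFunctions.
Variables (a A : R -> R) (alpha : R).
Hypothesis ha : smooth_circle a.
Hypothesis dA : forall t, derivable A t 1 /\ derive1 A t = a t - alpha.
Hypothesis pA : periodic A M.
Notation theta := (theta A).

Lemma torus_L2_tw p q : tw a A p -> tw a A q -> torus_L2 (fun z => p z +i* q z).
Proof.
move=> tp tq; have cp := tw_continuous ha dA tp; have cq := tw_continuous ha dA tq.
split.
- move=> t x; have [-> ->] := tw_periodic ha pA tp t x.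
  by have [-> ->] := tw_periodic ha pA tq t x.
- exact: (continuous2_measurable cp).
- exact: (continuous2_measurable cq).
- have := @tw_integrable R a A alpha ha dA _ (tw_add (tw_mul tp tp) (tw_mul tq tq)).
  by congr (_.-integrable _ _); apply/funext => z; rewrite normc_sqr !expr2.
Qed.

(** The derivative of p phi has integral 0. As phi is an arbitrary test function, p phi may leave
    [tw], so [Rintegral_partial_t] is applied directly. *)
Lemma tw_ibp_t p phi : tw a A p -> smooth_torus phi ->
  ip p (partial_t phi) = - ip (partial_t p) phi.
Proof.
move=> tp [pphi sphi]; have dp := tw_differentiable ha dA tp.
have dphi z : differentiable phi z := sphi [::] z.
have cphi : continuous phi by move=> z; exact/differentiable_continuous.
have cphit : continuous (partial_t phi).
  by move=> z; apply/differentiable_continuous; exact: (sphi [:: true] z).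
have cp := tw_continuous ha dA tp; have cpt := tw_continuous ha dA (tw_partial ha dA tp).1.
have E : partial_t (fun z => p z * phi z) = fun z => p z * partial_t phi z + phi z * partial_t p z.
  exact: partialM.
have : \int[leb2]_(z in cell) partial_t (fun z => p z * phi z) z = 0.
  apply: Rintegral_partial_t.
  - by move=> t x; have [-> ->] := tw_periodic ha pA tp t x; have [-> ->] := pphi t x.
  - by move=> z; exact: differentiableM.
  - rewrite E => z; apply: (@continuousD _ _ _ (fun z => p z * partial_t phi z)).
      by apply: continuousM; [exact: cp|exact: cphit].
    by apply: continuousM; [exact: cphi|exact: cpt].
rewrite E RintegralD//.
- move/eqP; rewrite addr_eq0 => /eqP; rewrite /ip => ->; congr (- _).
  by apply: eq_Rintegral => z _; rewrite mulrC.
- exact: (sqint_mul mC (continuous_sqint cp) (continuous_sqint cphit)).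
- exact: (sqint_mul mC (continuous_sqint cphi) (continuous_sqint cpt)).
Qed.

Lemma tw_ibp_x p phi : tw a A p -> smooth_torus phi ->
  ip p (partial_x phi) = - ip (partial_x p) phi.
Proof.
move=> tp [pphi sphi]; have dp := tw_differentiable ha dA tp.
have dphi z : differentiable phi z := sphi [::] z.
have cphi : continuous phi by move=> z; exact/differentiable_continuous.
have cphix : continuous (partial_x phi).
  by move=> z; apply/differentiable_continuous; exact: (sphi [:: false] z).
have cp := tw_continuous ha dA tp; have cpx := tw_continuous ha dA (tw_partial ha dA tp).2.
have E : partial_x (fun z => p z * phi z) = fun z => p z * partial_x phi z + phi z * partial_x p z.
  exact: partialM.
have : \int[leb2]_(z in cell) partial_x (fun z => p z * phi z) z = 0.
  apply: Rintegral_partial_x.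
  - by move=> t x; have [-> ->] := tw_periodic ha pA tp t x; have [-> ->] := pphi t x.
  - by move=> z; exact: differentiableM.
  - rewrite E => z; apply: (@continuousD _ _ _ (fun z => p z * partial_x phi z)).
      by apply: continuousM; [exact: cp|exact: cphix].
    by apply: continuousM; [exact: cphi|exact: cpx].
rewrite E RintegralD//.
- move/eqP; rewrite addr_eq0 => /eqP; rewrite /ip => ->; congr (- _).
  by apply: eq_Rintegral => z _; rewrite mulrC.
- exact: (sqint_mul mC (continuous_sqint cp) (continuous_sqint cphix)).
- exact: (sqint_mul mC (continuous_sqint cphi) (continuous_sqint cpx)).
Qed.

Lemma Cintegral_eq (f g : R * R -> R[i]) (p q : R * R -> R) :
  ip (fun z => complex.Re (f z)) p = - ip (fun z => complex.Re (g z)) q ->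
  ip (fun z => complex.Im (f z)) p = - ip (fun z => complex.Im (g z)) q ->
  torus_Cintegral (fun z => f z * (p z)%:C) = - torus_Cintegral (fun z => g z * (q z)%:C).
Proof.
have E (f' : R * R -> R[i]) (p' : R * R -> R) : torus_Cintegral (fun z => f' z * (p' z)%:C) =
    (ip (fun z => complex.Re (f' z)) p') +i* (ip (fun z => complex.Im (f' z)) p').
  rewrite /torus_Cintegral; congr (_ +i* _); apply: eq_Rintegral => z _.
    by rewrite ReM_real.
  by rewrite ImM_real.
by rewrite !E => -> ->.
Qed.

Lemma H1_gradient_tw p q : tw a A p -> tw a A q ->
  H1_gradient (fun z => p z +i* q z) (fun z => partial_t p z +i* partial_t q z)
    (fun z => partial_x p z +i* partial_x q z).
Proof.
move=> tp tq; have [tpt tpx] := tw_partial ha dA tp; have [tqt tqx] := tw_partial ha dA tq.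
split; try exact: torus_L2_tw.
- by move=> phi sphi; apply: Cintegral_eq => /=; exact: tw_ibp_t.
- by move=> phi sphi; apply: Cintegral_eq => /=; exact: tw_ibp_x.
Qed.

Lemma L2norm_wave (r : R) j :
  L2norm (fun z => (- sin (theta j z) * r) +i* (cos (theta j z) * r)) = `|r| * M.
Proof.
rewrite /L2norm (@eq_Rintegral _ _ _ _ _ (fun=> r ^+ 2)); last first.
  by move=> z _; rewrite normc_sqr /= !exprMn sqrrN -mulrDl addrC cos2Dsin2 mul1r.
rewrite Rintegral_cst; last exact: mC.
rewrite [X in fine X](_ : _ = (M ^+ 2)%:E)//; last exact: lebesgue2_cell.
by rewrite /= -exprMn sqrtr_sqr normrM [X in _ * X]gtr0_norm// per_gt0.
Qed.

Lemma L2norm_exp j : L2norm (fun z => cos (theta j z) +i* sin (theta j z)) = M.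
Proof.
rewrite /L2norm (@eq_Rintegral _ _ _ _ _ (fun=> 1)); last first.
  by move=> z _; rewrite normc_sqr /= cos2Dsin2.
rewrite Rintegral_cst; last exact: mC.
rewrite [X in fine X](_ : _ = (M ^+ 2)%:E)//; last exact: lebesgue2_cell.
by rewrite /= mul1r sqrtr_sqr gtr0_norm// per_gt0.
Qed.

(** For f = exp(i theta) the norms of f and Yf are M and |l + k alpha| M, and the gradient is at
    most M (|l| + (K + 1) |k|), where K bounds a - alpha. Both sides have degree delta in f, so M
    cancels. *)
Lemma poincare_frequencies delta : directional_poincare a delta ->
  exists2 c : R, 0 < c & exists2 K : R, 0 <= K & forall l k : int, (l, k) != 0 ->
    c <= (`|l%:~R| + K * `|k%:~R|) `^ (delta - 1) * `|l%:~R + k%:~R * alpha|.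
Proof.
move=> [d2 [c c0 H]]; exists c => //.
have [K aK] := continuous_cell_bounded (@continuous_coef R a A alpha ha dA alpha).
have K0 : 0 <= K.
  apply: le_trans (aK (0, 0) _) => //.
  by split => /=; rewrite in_itv/= lexx ltW// per_gt0.
exists (K + 1); first by rewrite addr_ge0.
move=> l k lk; set j := (l, k).
have Mp := @per_gt0 R.
have := H _ _ _ (H1_gradient_tw (tw_cos a A j) (tw_sin a A j)).
rewrite L2norm_exp (partial_t_cos dA) (partial_t_sin dA) (partial_x_cos A) (partial_x_sin A) /=.
have -> : torus_Cintegral (fun z => cos (theta j z) +i* sin (theta j z)) = 0.
  rewrite /torus_Cintegral /= (Rintegral_cos ha dA pA) (Rintegral_sin ha dA pA).
  by rewrite (negbTE lk).
move=> /(_ erefl).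
have -> : directional a (fun z => (- sin (theta j z) * (l%:~R - k%:~R * (a z.1 - alpha)))
    +i* (cos (theta j z) * (l%:~R - k%:~R * (a z.1 - alpha))))
   (fun z => (- sin (theta j z) * k%:~R) +i* (cos (theta j z) * k%:~R)) =
   fun z => (- sin (theta j z) * (l%:~R + k%:~R * alpha)) +i* (cos (theta j z) * (l%:~R + k%:~R
     * alpha)).
  by apply/funext => z; rewrite /directional; apply/eqP; rewrite eq_complex /=; apply/andP;
    split; apply/eqP; ring.
rewrite L2norm_wave.
set G := L2norm2 _ _ => h.
pose B : R := `|l%:~R| + (K + 1) * `|k%:~R|.
have B0 : 0 <= B by rewrite addr_ge0// mulr_ge0// addr_ge0.
have GB : G <= B * M.
  rewrite -(@ler_pXn2r _ 2) ?nnegrE ?sqrtr_ge0 ?mulr_ge0 ?(ltW Mp)//.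
  rewrite /G L2norm2_sqr L2norm_wave.
  pose fr (z : R * R) : R := l%:~R - k%:~R * (a z.1 - alpha).
  have tfr : tw a A fr := tw_freq a A alpha j.
  have frK z : cell z -> `|fr z| <= `|l%:~R| + `|k%:~R| * K.
    move=> cz; rewrite (le_trans (ler_normB _ _))// lerD2l normrM ler_wpM2l//.
    exact: aK.
  have cfr := tw_continuous ha dA tfr.
  have Ls : sqint (fun z => - sin (theta j z) * fr z).
    exact/(tw_sqint ha dA)/tw_mul/tfr/tw_N/tw_sin.
  have Lc : sqint (fun z => cos (theta j z) * fr z).
    exact/(tw_sqint ha dA)/tw_mul/tfr/tw_cos.
  rewrite L2norm_sqr//= -/fr.
  have mfr := continuous2_measurable cfr.
  have sS : sqint (fun z => - sin (theta j z)) by exact/(tw_sqint ha dA)/tw_N/tw_sin.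
  have sC : sqint (fun z => cos (theta j z)) by exact/(tw_sqint ha dA)/tw_cos.
  have hs := ipM_bdd_le mC sS mfr frK.
  have hc := ipM_bdd_le mC sC mfr frK.
  have hsc : ip (fun z => - sin (theta j z)) (fun z => - sin (theta j z)) +
      ip (fun z => cos (theta j z)) (fun z => cos (theta j z)) = M ^+ 2.
    rewrite -(RintegralD mC (sqint_mul mC sS sS) (sqint_mul mC sC sC)).
    rewrite (@eq_Rintegral _ _ _ _ _ (fun=> 1)); last first.
      by move=> z _; rewrite mulrNN -!expr2 addrC cos2Dsin2.
    rewrite Rintegral_cst; last exact: mC.
    by rewrite [X in fine X](_ : _ = (M ^+ 2)%:E) ?mul1r//; exact: lebesgue2_cell.
  apply: le_trans (lerD (lerD hs hc) (lexx _)) _.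
  rewrite -mulrDr hsc !exprMn -mulrDl; apply: ler_wpM2r; first exact: sqr_ge0.
  (* Taking K + 1 in B makes room for the term k^2 of the x-derivative. *)
  have -> : B ^+ 2 = (`|l%:~R| + `|k%:~R| * K) ^+ 2 + `|k%:~R| ^+ 2 +
      2 * (`|k%:~R| * (`|l%:~R| + `|k%:~R| * K)) by rewrite /B; ring.
  by rewrite lerDl mulr_ge0// mulr_ge0// addr_ge0// mulr_ge0.
rewrite -/B; have M0 : 0 < M `^ delta by exact: powR_gt0.
rewrite -(ler_pM2r M0); apply: le_trans h _.
have -> : B `^ (delta - 1) * `|l%:~R + k%:~R * alpha| * M `^ delta =
   (B * M) `^ (delta - 1) * (`|l%:~R + k%:~R * alpha| * M).
  rewrite powRM ?(ltW Mp)// -(@mulr_powRB1 R M delta) ?(ltW Mp)//; [ring|lra].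
apply: ler_wpM2r; first by rewrite mulr_ge0// ltW.
by apply: ge0_ler_powR => //; rewrite ?nnegrE ?sqrtr_ge0 ?mulr_ge0 ?(ltW Mp)//; lra.
Qed.

End TestFunctions.

(** A rational alpha would make an eigenvalue vanish, against c > 0. Otherwise l = -p and k = q give
    |alpha - p/q| >= |q|^(-delta) / T when this distance is below 1. *)
Lemma exponent_of_frequencies (alpha delta c K : R) : 1 <= delta -> 0 < c -> 0 <= K ->
  (forall l k : int, (l, k) != 0 ->
    c <= (`|l%:~R| + K * `|k%:~R|) `^ (delta - 1) * `|l%:~R + k%:~R * alpha|) ->
  irrational alpha /\ approximation_exponent alpha (delta + 1).
Proof.
move=> d1 c0 K0 H; split.
  move=> [r _ rE]; have q0 : denq r != 0 by exact: denq_neq0.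
  have ne : (- numq r, denq r) != 0 by apply: contra q0 => /eqP[_ ->].
  have q0R : (denq r)%:~R != 0 :> R by rewrite intr_eq0.
  have := H _ _ ne; rewrite (_ : _ + _ * alpha = 0).
    by rewrite normr0 mulr0 => /(lt_le_trans c0); rewrite ltxx.
  by rewrite -rE /ratr mulrNz mulrCA mulfV// mulr1 addNr.
(* When |alpha - p/q| < 1, |p| + K |q| is at most L |q|. *)
pose L : R := `|alpha| + 1 + K; have L1 : 1 <= L by rewrite /L -addrA addrCA lerDl addr_ge0.
have L0 : 0 < L by exact: lt_le_trans L1.
pose T := L `^ (delta - 1) / c; have T0 : 0 < T by rewrite divr_gt0// powR_gt0.
split; first by rewrite ltr_wpDl//; lra.
(* Past this threshold |q| >= T, so one more factor |q| absorbs T; hence the exponent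
   [delta + 1]. *)
exists (Num.truncn T).+1 => p q Nq.
have q0 : q != 0 by rewrite -absz_gt0; exact: leq_ltn_trans Nq.
have q1 := @natr_ge1 R q q0; have qp : 0 < `|q|%N%:R :> R by exact: lt_le_trans q1.
have Tq : T <= `|q|%N%:R by rewrite ltW// (lt_trans (truncnS_gt _))// ltr_nat.
have [x1|x1] := leP 1 `|alpha - p%:~R / q%:~R|.
  apply: le_trans x1; rewrite -[leRHS](powRr0 `|q|%N%:R) ler_powR//; lra.
have q0R : q%:~R != 0 :> R by rewrite intr_eq0.
have := H (- p) q; rewrite mulrNz normrN => Hpq.
have {Hpq} h : c <= (`|p%:~R| + K * `|q%:~R|) `^ (delta - 1) * `|- p%:~R + q%:~R * alpha|.
  by apply: Hpq; apply: contra q0 => /eqP[_ ->].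
have E : `|- p%:~R + q%:~R * alpha| = `|q|%N%:R * `|alpha - p%:~R / q%:~R|.
  by rewrite -normr_intr_absz -normrM; congr `|_|; field.
have pq : `|p%:~R| <= (`|alpha| + 1) * `|q|%N%:R :> R.
  have -> : p%:~R = (alpha - (alpha - p%:~R / q%:~R)) * q%:~R :> R by field.
  rewrite normrM normr_intr_absz; apply: ler_wpM2r; first exact: ltW.
  by rewrite (le_trans (ler_normB _ _))// lerD2l ltW.
have Lq : (`|p%:~R| + K * `|q%:~R|) `^ (delta - 1) <= (L * `|q|%N%:R) `^ (delta - 1).
  apply: ge0_ler_powR; rewrite ?nnegrE.
  - by lra.
  - by rewrite addr_ge0// mulr_ge0.
  - by rewrite mulr_ge0 ?(ltW L0).
  - by rewrite /L [leRHS]mulrDl; apply: lerD; [exact: pq|rewrite normr_intr_absz].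
move: h; rewrite E => h; set d := `|alpha - _| in x1 h *.
have {}h : c <= (L * `|q|%N%:R) `^ (delta - 1) * (`|q|%N%:R * d).
  apply: le_trans h _; apply: ler_wpM2r => //.
  by apply: mulr_ge0; [exact: ltW|exact: normr_ge0].
have e1 : `|q|%N%:R `^ (delta - 1) * `|q|%N%:R = `|q|%N%:R `^ delta :> R.
  by rewrite mulrC mulr_powRB1 ?ltW//; lra.
rewrite powRM ?(ltW L0)// in h.
have Qd := powR_gt0 delta qp.
have h2 : 1 <= T * `|q|%N%:R `^ delta * d.
  rewrite -(ler_pM2l c0) mulr1; apply: le_trans h _; rewrite -e1 /T.
  by rewrite le_eqVlt; apply/orP; left; apply/eqP; field; rewrite gt_eqF.
have h3 : 1 <= `|q|%N%:R `^ (delta + 1) * d.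
  apply: le_trans h2 _; apply: ler_wpM2r; first exact: normr_ge0.
  rewrite powRD ?powRr1 ?(ltW qp)//; last by apply/implyP => _; rewrite gt_eqF.
  by rewrite mulrC; apply: ler_wpM2l => //; exact: ltW.
have Q1 := powR_gt0 (delta + 1) qp.
by rewrite powRN -[leLHS]mul1r ler_pdivrMr// mulrC.
Qed.

Lemma diophantine_of_poincare (a : R -> R) delta : smooth_circle a ->
  directional_poincare a delta ->
  irrational (circle_mean a) /\ ~ liouville (circle_mean a).
Proof.
move=> ha Hd; have d2 := Hd.1.
have [A [dA pA]] := circle_primitive (smooth_circle_continuous ha) ha.1.
have [c c0 [K K0 H]] := poincare_frequencies ha dA pA Hd.
have [|ia ex] := exponent_of_frequencies _ c0 K0 H; first by lra.
by split => //; exact: not_liouville_of_exponent ex.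
Qed.

End Converse.

Theorem corollary5p3 (R : realType) (a : R -> R) (ha : smooth_circle a) :
  ((exists delta : R, directional_poincare a delta) <->
     irrational (circle_mean a) /\ ~ liouville (circle_mean a)) /\
  (irrational (circle_mean a) /\ ~ liouville (circle_mean a) ->
     (forall delta : R,
        (irrationality_measure (circle_mean a) < delta%:E)%E ->
        directional_poincare a delta) /\
     (algebraic_of_degree (circle_mean a) 2 -> directional_poincare a 2)).
Proof.
(* Every approximation exponent is an admissible delta; only the quadratic case, where delta = 2 is
   not such an exponent, is argued apart. *)
have poincare mu : irrational (circle_mean a) -> approximation_exponent (circle_mean a) mu ->
    directional_poincare a mu.
  move=> ia amu; apply: poincare_of_diophantine => //.
    exact: ltW (approximation_exponent_gt2 ia amu).
  exact: diophantine_of_exponent ia amu.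
split; first split.
- by move=> [delta]; exact: diophantine_of_poincare.
- move=> [ia nl]; have [mu amu] := exponent_of_not_liouville ia nl.
  by exists mu; exact: poincare.
- move=> [ia _]; split=> [delta|alg].
    by move=> /exponent_of_measure_lt; exact: poincare.
  by apply: poincare_of_diophantine => //; exact: diophantine_quadratic.
Qed.
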